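(* Let $\mathbf{T}=(T_1,\dots,T_d)\in\mathfrak{B}(\mathcal{H})^d$. Then for any $t\in[0,1]$, with $r_0=\min\{t,1-t\}$, $$\|\widehat{\mathbf{T}}(t)\|\le 2r_0\|\widetilde{\mathbf{T}}\|+(1-2r_0)\|\widehat{\mathbf{T}}\|\le\|\widehat{\mathbf{T}}\|\le\|\mathbf{T}\|.$$ In particular, $\|\widetilde{\mathbf{T}}\|\le\|\widehat{\mathbf{T}}\|\le\|\mathbf{T}\|$.
   Context: $\mathcal{H}$ is a separable complex Hilbert space, $\mathfrak{B}(\mathcal{H})$ the bounded linear operators on $\mathcal{H}$, and $d\in\mathbb{N}$. The spherical (joint) operator norm of a tuple $\mathbf{T}=(T_1,\dots,T_d)\in\mathfrak{B}(\mathcal{H})^d$ is $\|\mathbf{T}\|=\sup\{(\sum_{k=1}^d\|T_kx\|^2)^{1/2}: x\in\mathcal{H},\ \|x\|=1\}$. Canonical spherical polar decomposition: $\mathbf{T}=\mathbf{V}P=(V_1P,\dots,V_dP)$, where $P=\sqrt{T_1^*T_1+\cdots+T_d^*T_d}$ and $\mathbf{V}=(V_1,\dots,V_d)$, viewed as a column operator $\mathcal{H}\to\mathcal{H}^d$, is the partial isometry with initial space $\mathcal{N}(P)^\perp$; that is, $T_i=V_iP$ for all $i$ and $\sum_{i=1}^dV_i^*V_i$ is the orthogonal projection onto $\mathcal{N}(P)^\perp=\overline{\mathcal{R}(P)}$. The convention $P^0=I$ is used. For $t\in[0,1]$: the generalized spherical Aluthge transform is $\widetilde{\mathbf{T}}(t)=(P^tV_1P^{1-t},\dots,P^tV_dP^{1-t})$;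 the spherical Aluthge transform is $\widetilde{\mathbf{T}}=\widetilde{\mathbf{T}}(1/2)$; the spherical Duggal transform is $\mathbf{T}^D=(PV_1,\dots,PV_d)$; the spherical mean transform is $\widehat{\mathbf{T}}=\frac12(\mathbf{T}+\mathbf{T}^D)$; the spherical Heinz transform is $\widehat{\mathbf{T}}(t)=\frac12(\widetilde{\mathbf{T}}(t)+\widetilde{\mathbf{T}}(1-t))$. Sums and scalar multiples of tuples are taken coordinatewise. *)

(* Defs.v *)
From mathcomp Require Import all_boot all_order all_algebra.
From mathcomp Require Import complex.
From mathcomp Require Import all_classical all_reals all_analysis.

Set Implicit Arguments.
Unset Strict Implicit.
Unset Printing Implicit Defensive.

Import Order.TTheory GRing.Theory Num.Theory.
Import numFieldNormedType.Exports.

Local Open Scope classical_set_scope.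
Local Open Scope complex_scope.
Local Open Scope ring_scope.

(* A complex Hilbert space is presented as a complete normed module [H] over
   [R[i]] together with a positive definite hermitian form [ip], linear in its
   first argument, inducing the norm of [H]. *)
Definition induces_norm (R : realType) (H : completeNormedModType R[i])
    (ip : {dot H for Num.conj}) : Prop :=
  forall x : H, `|x| ^+ 2 = ip x x.

Definition separable (H : topologicalType) : Prop :=
  exists D : set H, countable D /\ dense D.

Section Operators.
Context (R : realType) (H : completeNormedModType R[i]).
Implicit Types (A P : H -> H) (x y : H).

(* Norms of vectors live in [R[i]]; this is the same number in [R]. *)
Definition normR x : R := complex.Re `|x|.

(* For linear maps, continuity is boundedness
   ([linear_bounded_continuous], [linear_boundedP]). *)
Definition bounded_operator A : Prop := linear A /\ continuous A.

Definition opnorm A : R := sup [set normR (A x) | x in [set x | `|x| = 1]].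

Definition joint_norm (d : nat) (T : 'I_d -> H -> H) : R :=
  sup [set Num.sqrt (\sum_(k < d) normR (T k x) ^+ 2)
        | x in [set x | `|x| = 1]].

Definition poly_op (p : {poly R}) A : H -> H :=
  fun x => \sum_(k < size p) (p`_k)%:C *: iter k A x.

(* [B] is the value f(A) of the continuous functional calculus of the positive
   operator [A], whose spectrum is contained in [0, ||A||]: [B] is the norm
   limit of p_n(A) for polynomials p_n converging to f uniformly there. *)
Definition is_functional_calculus (f : R -> R) A (B : H -> H) : Prop :=
  bounded_operator B /\
  exists p : nat -> {poly R},
    (forall e : R, 0 < e -> \forall n \near \oo,
       forall s : R, 0 <= s <= opnorm A -> `|(p n).[s] - f s| <= e) /\
    opnorm (poly_op (p n) A - B) @[n --> \oo] --> (0 : R).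

(* [powR] satisfies [0 `^ 0 = 1], so the exponent 0 gives the identity. *)
Definition op_pow A (t : R) : H -> H :=
  xget 0 [set B | is_functional_calculus (fun s : R => s `^ t) A B].

Context (ip : {dot H for Num.conj}).

(* For every bounded [A] the adjoint exists and is unique (Riesz). *)
Definition adjoint A : H -> H :=
  xget 0 [set B | bounded_operator B /\ forall x y, ip (A x) y = ip x (B y)].

(* On a complex Hilbert space positivity includes self-adjointness; the order
   of [R[i]] makes [0 <= z] entail that z is real. *)
Definition positive_operator A : Prop :=
  bounded_operator A /\ forall x, 0 <= ip (A x) x.

Definition orthogonal_complement (M : set H) : set H :=
  [set x | forall y, M y -> ip x y = 0].

Definition is_orthogonal_projection (Q : H -> H) (M : set H) : Prop :=
  forall x, M (Q x) /\ forall y, M y -> ip (x - Q x) y = 0.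

Definition is_positive_sqrt P A : Prop :=
  positive_operator P /\ P \o P = A.

Definition spherical_polar (d : nat) (T V : 'I_d -> H -> H) P : Prop :=
  [/\ is_positive_sqrt P (\sum_(k < d) (adjoint (T k) \o T k)),
      forall k, bounded_operator (V k),
      forall k, T k = V k \o P
    & is_orthogonal_projection (\sum_(k < d) (adjoint (V k) \o V k))
        (orthogonal_complement [set x | P x = 0])].

End Operators.

Section Transforms.
Context (R : realType) (H : completeNormedModType R[i]) (d : nat).
Implicit Types (T V : 'I_d -> H -> H) (P : H -> H).

(* [V] and [P] are the factors of the polar decomposition T = V P. *)
Definition gen_aluthge V P (t : R) : 'I_d -> H -> H :=
  fun k => op_pow P t \o V k \o op_pow P (1 - t).

Definition aluthge V P : 'I_d -> H -> H := gen_aluthge V P (1 / 2).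

Definition duggal V P : 'I_d -> H -> H := fun k => P \o V k.

Definition spherical_mean T V P : 'I_d -> H -> H :=
  fun k x => (1 / 2 : R)%:C *: (T k x + duggal V P k x).

Definition heinz V P (t : R) : 'I_d -> H -> H :=
  fun k x => (1 / 2 : R)%:C *:
    (gen_aluthge V P t k x + gen_aluthge V P (1 - t) k x).

End Transforms.

(* Main.v *)
From HB Require Import structures.
Require Import Defs.
From mathcomp Require Import all_boot all_order all_algebra.
From mathcomp Require Import complex.
From mathcomp Require Import all_classical all_reals all_analysis.
From mathcomp Require Import ring lra.

Import Order.TTheory GRing.Theory Num.Theory.
Import numFieldNormedType.Exports.

Set Implicit Arguments.
Unset Strict Implicit.
Unset Printing Implicit Defensive.

Local Open Scope classical_set_scope.
Local Open Scope complex_scope.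
Local Open Scope ring_scope.

(** Write F(t) for the column operator with entries
    1/2 (P^t V_k P^(1-t) + P^(1-t) V_k P^t), so that F(0) is the spherical mean
    transform and F(1/2) the spherical Aluthge transform, and let
    f(t) = ||F(t)||. The first two inequalities follow from f being convex and
    symmetric under t |-> 1 - t.

    Midpoint convexity of f comes from the operator arithmetic-geometric mean
    inequality ||A Z A|| <= 1/2 ||A^2 Z + Z A^2|| for self-adjoint A
    ([operator_am_gm]). For a <= b apply it to A = P^((b-a)/2) and
    Z = 1/2 (P^a V P^(1-b) + P^(1-b) V P^a): then A Z A = F((a+b)/2) and
    A^2 Z + Z A^2 = F(a) + F(b) ([heinz_mean_midpoint]). The inequality itself
    is obtained by testing the form of A^2 Z + Z A^2 on the images under A of
    approximate singular vectors of A Z A.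

    The function t |-> P^t is in general discontinuous in norm at 0, because
    P^0 = I while P^t tends to the projection onto the closure of the range of P.
    Midpoint convexity is therefore turned into the interpolation inequality
    f(t) <= 2t f(1/2) + (1-2t) f(0) using boundedness of f instead of
    continuity ([bounded_midconvex_interpolation]). The case a = 0, b = 1 of
    midpoint convexity gives f(1/2) <= f(0).

    For f(0) <= ||T||, the equality ||T x|| = ||P x|| gives ||P|| <= ||T||,
    and V is a contraction, so the tuple P V has joint norm at most ||T||; the
    mean of T and P V obeys the same bound ([mean_le]).

    What has to be built first: adjoints, through the Riesz representation
    theorem obtained by minimising ||u||^2 - 2 f(u); and the powers P^t. The
    latter rest on the spectral bound ||p(P)|| <= sup |p| over [0, ||P||] for
    polynomials ([poly_op_bound]), which makes the calculus of continuous
    functions well defined and multiplicative ([fc_mul]), and on the uniform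
    approximation of s |-> s^t by Bernstein polynomials ([powR_approx]). *)

(** * Midpoint convex functions *)

(** Every point of [[a, b]] is the midpoint of a subinterval having [a] or [b] as an
    endpoint. As [g] is nonpositive there, an upper bound [C >= 0] of [g]
    improves to [C / 2], hence to [C / 2 ^+ n] for all [n]. *)
Lemma bounded_midconvex_le0 (R : realType) (g : R -> R) (C a b : R) :
  (forall t, a <= t <= b -> g t <= C) -> g a <= 0 -> g b <= 0 ->
  (forall s t, a <= s -> s <= t -> t <= b ->
     g ((s + t) / 2) <= (g s + g t) / 2) ->
  forall t, a <= t <= b -> g t <= 0.
Proof.
move=> gC ga gb mid t tab.
have C0 : 0 <= `|C| by [].
have halving n : forall t, a <= t <= b -> g t <= `|C| / 2 ^+ n.
  elim: n => [|n IH] s /andP[as_ sb].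
    by rewrite expr0 divr1 (le_trans (gC s _)) ?as_// ler_norm.
  have -> : `|C| / 2 ^+ n.+1 = (`|C| / 2 ^+ n) / 2.
    by rewrite exprS invfM mulrA [in RHS]mulrAC.
  have [sm|ms] := leP s ((a + b) / 2).
    have := mid a (2 * s - a) (lexx a); have -> : (a + (2 * s - a)) / 2 = s by field.
    have := IH (2 * s - a); lra.
  have := mid (2 * s - b) b; have -> : (2 * s - b + b) / 2 = s by field.
  have := IH (2 * s - b); lra.
rewrite leNgt; apply/negP => gt0.
have := halving (Num.bound (`|C| / g t)) t tab.
have := archi_boundP (divr_ge0 C0 (ltW gt0)); set n := Num.bound _ => hn.
have n2 : n%:R < 2 ^+ n :> R by rewrite -natrX ltr_nat ltn_expl.
rewrite leNgt => /negP; apply; rewrite ltr_pdivrMr ?exprn_gt0// mulrC.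
by rewrite -ltr_pdivrMr// (lt_trans hn).
Qed.

(** The previous lemma for the difference of [f] and its chord. *)
Lemma bounded_midconvex_interpolation (R : realType) (f : R -> R) (C : R) :
  (forall t, 0 <= t <= 1 / 2 -> f t <= C) ->
  (forall a b, 0 <= a -> a <= b -> b <= 1 / 2 ->
     f ((a + b) / 2) <= (f a + f b) / 2) ->
  forall t, 0 <= t <= 1 / 2 -> f t <= 2 * t * f (1 / 2) + (1 - 2 * t) * f 0.
Proof.
move=> fC mid t t01.
pose g s := f s - (2 * s * f (1 / 2) + (1 - 2 * s) * f 0).
suff : g t <= 0 by rewrite /g subr_le0.
apply: (@bounded_midconvex_le0 _ g (C + (`|f (1 / 2)| + `|f 0|)) 0 (1 / 2)) => //.
- move=> s s01; have := fC s s01; rewrite /g.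
  move: (f s) (f (1 / 2)) (f 0) => u v w uC.
  have hv : - v <= `|v| by rewrite -normrN ler_norm.
  have hw : - w <= `|w| by rewrite -normrN ler_norm.
  have := normr_ge0 v; have := normr_ge0 w.
  move: (`|w|) (`|v|) hv hw => p q hv hw p0 q0.
  have : 0 <= 2 * s * (q + v) by rewrite mulr_ge0; lra.
  have : 0 <= (1 - 2 * s) * (p + w) by rewrite mulr_ge0; lra.
  have : 0 <= (1 - 2 * s) * q by rewrite mulr_ge0; lra.
  have : 0 <= 2 * s * p by rewrite mulr_ge0; lra.
  by lra.
- by rewrite /g; move: (f 0) (f (1 / 2)) => u v; lra.
- by rewrite /g; move: (f 0) (f (1 / 2)) => u v; lra.
- move=> a b a0 ab b2; have := mid a b a0 ab b2; rewrite /g.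
  by move: (f _) (f a) (f b) (f 0) (f (1 / 2)) => u1 u2 u3 u4 u5; lra.
Qed.

(** * Polynomial approximation of real powers *)

Section PowerApproximation.
Context (R : realType).
Implicit Types (x u h e t : R) (n : nat).

(** The Bernstein polynomial whose [k]-th coefficient in the Bernstein basis of
    degree [n] is [g k], in the form given by the algorithm of de Casteljau. The
    recursion makes estimates provable by induction, without binomial sums. *)
Fixpoint bernstein n (g : nat -> R) : {poly R} :=
  if n is m.+1 then
    (1 - 'X) * bernstein m g + 'X * bernstein m (g \o succn)
  else (g 0%N)%:P.

(** The value at [x] is the expectation of [g] under the binomial law with
    parameters [n] and [x], and [n x (1 - x) + (n x - m)^2] is the second moment
    of that law around [m]; both sides satisfy the same recursion in [n]. *)
Lemma bernstein_dist n (g : nat -> R) (c a b x m : R) :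
  0 <= x <= 1 ->
  (forall k, (k <= n)%N -> `|g k - c| <= a + b * (k%:R - m) ^+ 2) ->
  `|(bernstein n g).[x] - c| <= a + b * (n%:R * x * (1 - x) + (n%:R * x - m) ^+ 2).
Proof.
move=> /andP[x0 x1]; elim: n g m => [|n IH] g m gc /=.
  by rewrite hornerC (le_trans (gc 0%N _))// !mul0r !add0r sqrrN.
rewrite !hornerE.
have h1 := IH g m (fun k kn => gc k (leqW kn)).
have := IH (g \o succn) (m - 1) => /(_ _)/wrap[k kn|h2].
  have -> : k%:R - (m - 1) = k.+1%:R - m by rewrite -natr1; ring.
  exact: gc.
have -> : (1 - x) * (bernstein n g).[x] + x * (bernstein n (g \o succn)).[x] - c =
  (1 - x) * ((bernstein n g).[x] - c) + x * ((bernstein n (g \o succn)).[x] - c).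
  by ring.
rewrite (le_trans (ler_normD _ _))// !normrM (ger0_norm x0) ger0_norm ?subr_ge0//.
have := lerD (ler_wpM2l (_ : 0 <= 1 - x) h1) (ler_wpM2l x0 h2).
rewrite subr_ge0 => /(_ x1)/le_trans; apply.
by rewrite -natr1 le_eqVlt; apply/orP; left; apply/eqP; ring.
Qed.

(** For [0 <= u <= x + h] the fraction [u / (x + h)] is at most its [t]-th power. *)
Lemma powR_subadd x h t : 0 <= t <= 1 -> 0 <= x -> 0 <= h ->
  (x + h) `^ t <= x `^ t + h `^ t.
Proof.
move=> /andP[t0 t1] x0 h0.
have := addr_ge0 x0 h0; rewrite le_eqVlt => /predU1P[s0|s0].
  move: (s0) => /esym/eqP; rewrite paddr_eq0// => /andP[/eqP-> /eqP->].
  by rewrite addr0 lerDl powR_ge0.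
have le_frac u : 0 <= u <= x + h -> u / (x + h) * (x + h) `^ t <= u `^ t.
  move=> /andP[u0 us].
  have us1 : u / (x + h) <= 1 by rewrite ler_pdivrMr ?mul1r.
  have v0 : 0 <= u / (x + h) by rewrite divr_ge0// ltW.
  have -> : u `^ t = (u / (x + h)) `^ t * (x + h) `^ t.
    by rewrite -powRM ?divfK ?gt_eqF ?(ltW s0).
  rewrite ler_wpM2r ?powR_ge0//; move: v0.
  rewrite le_eqVlt => /predU1P[<-|v0]; first by rewrite powR_ge0.
  by rewrite ger1_powR// v0.
have := lerD (le_frac x _) (le_frac h _).
rewrite x0 h0 lerDl lerDr x0 h0 => /(_ isT isT); apply: le_trans.
by rewrite -!mulrDl divff ?mul1r// gt_eqF.
Qed.

(** With [d `^ t = e], increments [u - x] below [d] contribute at most [e] by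
    subadditivity; for the others the left-hand side is at most
    [1 <= ((u - x) / d)^2]. *)
Lemma powR_modulus t e : 0 <= t <= 1 -> 0 < e -> exists2 b : R, 0 <= b &
  forall x u, 0 <= x <= 1 -> 0 <= u <= 1 ->
    `|u `^ t - x `^ t| <= e + b * (u - x) ^+ 2.
Proof.
move=> t01 e0; move: (t01) => /andP[]; rewrite le_eqVlt => /predU1P[<- _|t0 t1].
  by exists 0 => // x u _ _; rewrite !powRr0 subrr normr0 mul0r addr0 ltW.
pose d := e `^ t^-1; have d0 : 0 < d by rewrite powR_gt0.
have dt : d `^ t = e by rewrite -powRrM mulVf ?gt_eqF// powRr1// ltW.
exists (d ^- 2); first by rewrite invr_ge0 sqr_ge0.
move=> x u; wlog xu : x u / x <= u.
  move=> wl x01 u01; have [xu|/ltW ux] := leP x u; first exact: wl.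
  by rewrite distrC -[(u - x) ^+ 2]sqrrN opprB wl.
move=> /andP[x0 x1] /andP[u0 u1].
have h0 : 0 <= u - x by rewrite subr_ge0.
rewrite ger0_norm ?subr_ge0 ?ge0_ler_powR ?nnegrE// ?(ltW t0)//.
have [hd|dh] := leP (u - x) d.
  have := powR_subadd t01 x0 h0; rewrite addrC subrK => hx.
  have hd' : (u - x) `^ t <= e by rewrite -dt ge0_ler_powR ?nnegrE// ltW.
  have : 0 <= d ^- 2 * (u - x) ^+ 2 by rewrite mulr_ge0 ?invr_ge0 ?sqr_ge0.
  by lra.
have ut : u `^ t <= 1.
  have -> : 1 = 1 `^ t by rewrite powR1.
  by rewrite ge0_ler_powR ?nnegrE// ltW.
have := powR_ge0 x t.
have : 1 <= d ^- 2 * (u - x) ^+ 2.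
  by rewrite mulrC ler_pdivlMr ?exprn_gt0// mul1r ler_sqr ?nnegrE// ltW.
by lra.
Qed.

Lemma powR_approx t M : 0 <= t <= 1 -> 0 <= M -> exists p : nat -> {poly R},
  forall e : R, 0 < e -> exists N, forall n, (N <= n)%N ->
    forall s, 0 <= s <= M -> `|(p n).[s] - s `^ t| <= e.
Proof.
move=> t01 M0; pose L := M + 1; have L0 : 0 < L by rewrite ltr_wpDl.
have Lt0 : 0 < L `^ t by rewrite powR_gt0.
(* Rescaling by M + 1 rather than M keeps the interval nondegenerate if M = 0. *)
exists (fun n => L `^ t *:
  (bernstein n.+1 (fun k => (k%:R / n.+1%:R) `^ t) \Po (L^-1 *: 'X))) => e e0.
have e20 : 0 < e / 2 / L `^ t by rewrite !divr_gt0.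
have [b b0 hb] := powR_modulus t01 e20.
have b20 : 0 <= b / (e / 2 / L `^ t) by rewrite divr_ge0// ltW.
exists (Num.bound (b / (e / 2 / L `^ t))) => n Nn s /andP[s0 sM].
pose x := s / L; have x0 : 0 <= x by rewrite divr_ge0// ltW.
have x1 : x <= 1 by rewrite ler_pdivrMr// mul1r (le_trans sM)// lerDl.
have -> : s `^ t = L `^ t * x `^ t by rewrite -powRM ?(ltW L0)// mulrC divfK// gt_eqF.
rewrite hornerZ horner_comp hornerZ hornerX [L^-1 * s]mulrC -/x -mulrBr normrM.
rewrite (ger0_norm (ltW Lt0)) mulrC -ler_pdivlMr//.
have n0 : 0 < n.+1%:R :> R by rewrite ltr0n.
have := @bernstein_dist n.+1 (fun k => (k%:R / n.+1%:R) `^ t) (x `^ t)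
  (e / 2 / L `^ t) (b / n.+1%:R ^+ 2) x (n.+1%:R * x).
rewrite x0 x1 => /(_ isT)/(_ _)/wrap[k kn|/le_trans].
  apply: (le_trans (hb x (k%:R / n.+1%:R) _ _)); first by rewrite x0.
    by rewrite divr_ge0// ler_pdivrMr// mul1r ler_nat.
  rewrite lerD2l -mulrA ler_wpM2l// le_eqVlt; apply/orP; left; apply/eqP.
  by field; rewrite gt_eqF.
apply; rewrite subrr expr0n addr0.
have -> : e / L `^ t = e / 2 / L `^ t + e / 2 / L `^ t by field; rewrite gt_eqF.
rewrite lerD2l.
have hN : b / (e / 2 / L `^ t) <= n.+1%:R.
  have := archi_boundP b20; move=> /ltW/le_trans; apply.
  by rewrite ler_nat leqW.
rewrite ler_pdivrMr// in hN.
have -> : b / n.+1%:R ^+ 2 * (n.+1%:R * x * (1 - x)) = b * (x * (1 - x)) / n.+1%:R.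
  by field; rewrite gt_eqF.
rewrite ler_pdivrMr// [leRHS]mulrC; apply: le_trans hN.
by rewrite ler_piMr//; nra.
Qed.

End PowerApproximation.

(** * The real inner product *)

Section Hilbert.
Context (R : realType) (H : completeNormedModType R[i]).
Context (ip : {dot H for Num.conj}) (ip_norm : induces_norm ip).
Implicit Types (x y z : H) (A B : H -> H).

(** All norm estimates below only involve real parts, so [H] is handled as a
    real inner product space; [rdot_ip] recovers the complex form. *)
Definition rdot x y : R := complex.Re (ip x y).

Lemma normRE x : `|x| = (normR x)%:C.
Proof.
rewrite /normR; have := normr_ge0 x; rewrite lecE/=.
by case: `|x| => a b /= /andP[/eqP-> _].
Qed.

Lemma normR_ge0 x : 0 <= normR x.
Proof. by have := normr_ge0 x; rewrite normRE lecR. Qed.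

Lemma normR_eq0 x : (normR x == 0) = (x == 0).
Proof. by rewrite -(normr_eq0 x) normRE (inj_eq (@complexI R)). Qed.

Lemma normR0 : normR (0 : H) = 0.
Proof. by rewrite /normR normr0. Qed.

Lemma normR_unit x : (`|x| = 1) <-> (normR x = 1).
Proof. by rewrite normRE; split => [|->//] => -[]. Qed.

Lemma normRD x y : normR (x + y) <= normR x + normR y.
Proof. by have := ler_normD x y; rewrite !normRE -rmorphD lecR. Qed.

Lemma normRN x : normR (- x) = normR x.
Proof. by rewrite /normR normrN. Qed.

Lemma normRB x y : normR (x - y) <= normR x + normR y.
Proof. by rewrite -(normRN y) normRD. Qed.

Lemma normRBC x y : normR (x - y) = normR (y - x).
Proof. by rewrite /normR distrC. Qed.

Lemma normR_tri x y z : normR (x - z) <= normR (x - y) + normR (y - z).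
Proof. by rewrite -[x - z](subrKA y) normRD. Qed.

Lemma normRZC (a : R[i]) x : normR (a *: x) = complex.Re `|a| * normR x.
Proof.
apply: (@complexI R); rewrite -normRE normrZ rmorphM/= -normRE.
by congr (_ * _); rewrite normc_def.
Qed.

Lemma normRZ (r : R) x : normR (r%:C *: x) = `|r| * normR x.
Proof. by rewrite normRZC normc_def /= expr0n addr0 sqrtr_sqr. Qed.

Lemma rdot_xx x : rdot x x = normR x ^+ 2.
Proof. by rewrite /rdot -ip_norm normRE -rmorphXn. Qed.

Lemma rdotC x y : rdot x y = rdot y x.
Proof.
have Re_conj (a : R[i]) : complex.Re (Num.conj a) = complex.Re a by case: a.
by rewrite /rdot hermC expr0 mul1r; exact: Re_conj.
Qed.

Lemma rdotDl x y z : rdot (x + y) z = rdot x z + rdot y z.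
Proof. by rewrite /rdot linearDl raddfD. Qed.

Lemma rdotZl (r : R) x y : rdot (r%:C *: x) y = r * rdot x y.
Proof.
by rewrite /rdot linearZl_LR /=; case: (ip x y) => a b /=; rewrite mul0r subr0.
Qed.

Lemma rdotil x y : rdot ('i *: x) y = - complex.Im (ip x y).
Proof.
by rewrite /rdot linearZl_LR /=; case: (ip x y) => a b /=; rewrite mul0r mul1r add0r.
Qed.

Lemma rdotNl x y : rdot (- x) y = - rdot x y.
Proof. by rewrite /rdot linearNl raddfN. Qed.

Lemma rdotDr x y z : rdot x (y + z) = rdot x y + rdot x z.
Proof. by rewrite !(rdotC x) rdotDl. Qed.

Lemma rdotZr (r : R) x y : rdot x (r%:C *: y) = r * rdot x y.
Proof. by rewrite !(rdotC x) rdotZl. Qed.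

Lemma rdotNr x y : rdot x (- y) = - rdot x y.
Proof. by rewrite !(rdotC x) rdotNl. Qed.

Lemma rdot0l y : rdot 0 y = 0.
Proof. by rewrite /rdot linear0l. Qed.

Lemma rdot_suml (I : finType) (F : I -> H) y :
  rdot (\sum_i F i) y = \sum_i rdot (F i) y.
Proof.
by apply: (big_morph (rdot ^~ y)) => [u v|]; rewrite (rdotDl, rdot0l).
Qed.

Lemma rdot_sumr (I : finType) (F : I -> H) y :
  rdot y (\sum_i F i) = \sum_i rdot y (F i).
Proof. by rewrite rdotC rdot_suml; apply: eq_bigr => i _; rewrite rdotC. Qed.

Lemma sqr_normRD x y :
  normR (x + y) ^+ 2 = normR x ^+ 2 + 2 * rdot x y + normR y ^+ 2.
Proof. by rewrite -!rdot_xx !(rdotDl, rdotDr) (rdotC y x); ring. Qed.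

Lemma sqr_normRB x y :
  normR (x - y) ^+ 2 = normR x ^+ 2 - 2 * rdot x y + normR y ^+ 2.
Proof. by rewrite sqr_normRD normRN rdotNr; ring. Qed.

Lemma rdot_sep x y : (forall h, rdot h x = rdot h y) -> x = y.
Proof.
move=> xy; apply/eqP; rewrite -subr_eq0 -normR_eq0 -sqrf_eq0 -rdot_xx.
by rewrite rdotDr rdotNr xy subrr.
Qed.

Lemma rdot_ip x y x' y' :
  (forall a : R[i], rdot (a *: x) y = rdot (a *: x') y') -> ip x y = ip x' y'.
Proof.
move=> e; have := e 1; have := e 'i; rewrite !scale1r !rdotil /rdot.
case: (ip x y) => a b; case: (ip x' y') => c d /=.
by move=> /oppr_inj-> ->.
Qed.

(** [\sum_k `|u a_k - v b_k|^2 >= 0] for all real [u] and [v]; families indexed by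
    [k] are the elements of the direct sum of [d] copies of [H]. *)
Lemma CauchySchwarz_family (d : nat) (a b : 'I_d -> H) (p q : R) :
  0 <= p -> 0 <= q ->
  \sum_k normR (a k) ^+ 2 <= p ^+ 2 -> \sum_k normR (b k) ^+ 2 <= q ^+ 2 ->
  \sum_k rdot (a k) (b k) <= p * q.
Proof.
move=> p0 q0 ap bq; set s := \sum_k rdot _ _.
have key (u v : R) :
    0 <= u ^+ 2 * p ^+ 2 - 2 * u * v * s + v ^+ 2 * q ^+ 2.
  apply: (@le_trans _ _ (\sum_k normR (u%:C *: a k - v%:C *: b k) ^+ 2)).
    by apply: sumr_ge0 => k _; rewrite sqr_ge0.
  rewrite (eq_bigr (fun k => u ^+ 2 * normR (a k) ^+ 2
     - 2 * u * v * rdot (a k) (b k) + v ^+ 2 * normR (b k) ^+ 2)); last first.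
    move=> k _; rewrite sqr_normRB !normRZ rdotZl rdotZr !exprMn.
    by rewrite !real_normK ?num_real//; ring.
  rewrite !big_split/= -!mulr_sumr sumrN -mulr_sumr -/s.
  have u2 : 0 <= u ^+ 2 by rewrite sqr_ge0.
  have v2 : 0 <= v ^+ 2 by rewrite sqr_ge0.
  by rewrite lerD// ?lerD2r ?ler_wpM2l.
have [p00|pN0] := eqVneq p 0.
  by have := key (q ^+ 2 + 1) s; have := sqr_ge0 q; rewrite p00; nra.
have [q00|qN0] := eqVneq q 0.
  by have := key s (p ^+ 2 + 1); have := sqr_ge0 p; rewrite q00; nra.
have pq : 0 < p * q by rewrite mulr_gt0// lt_neqAle eq_sym ?pN0 ?qN0.
have := key q p => h.
rewrite -(@ler_pM2l _ (p * q))//.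
by nra.
Qed.

Lemma CauchySchwarz x y : rdot x y <= normR x * normR y.
Proof.
have := @CauchySchwarz_family 1 (fun=> x) (fun=> y) _ _ (normR_ge0 x) (normR_ge0 y).
by rewrite !big_ord1; apply.
Qed.

Lemma Minkowski_family (d : nat) (a b : 'I_d -> H) (p q : R) :
  0 <= p -> 0 <= q ->
  \sum_k normR (a k) ^+ 2 <= p ^+ 2 -> \sum_k normR (b k) ^+ 2 <= q ^+ 2 ->
  \sum_k normR (a k + b k) ^+ 2 <= (p + q) ^+ 2.
Proof.
move=> p0 q0 ap bq; have ab := CauchySchwarz_family p0 q0 ap bq.
rewrite (eq_bigr _ (fun k _ => sqr_normRD (a k) (b k))) !big_split/= -mulr_sumr.
by nra.
Qed.

(** * Bounded operators *)

Lemma linear_pack A : linear A -> exists f : {linear H -> H}, A = f.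
Proof.
move=> linA; pose F := GRing.isLinear.Build _ _ _ _ A linA.
by exists (HB.pack_for {linear H -> H} A F).
Qed.

Lemma lin0 A : linear A -> A 0 = 0.
Proof. by move=> /linear_pack[f ->]; rewrite linear0. Qed.
Lemma linD A x y : linear A -> A (x + y) = A x + A y.
Proof. by move=> /linear_pack[f ->]; rewrite linearD. Qed.
Lemma linB A x y : linear A -> A (x - y) = A x - A y.
Proof. by move=> /linear_pack[f ->]; rewrite linearB. Qed.
Lemma linZ A (a : R[i]) x : linear A -> A (a *: x) = a *: A x.
Proof. by move=> /linear_pack[f ->]; rewrite linearZ. Qed.

Lemma bounded_operatorP A : bounded_operator A <->
  linear A /\ exists2 K : R, 0 <= K & forall x, normR (A x) <= K * normR x.
Proof.
split => -[linA].
  move=> cA; split => //; have [f fA] := linear_pack linA.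
  move: cA; rewrite fA => /linear_bounded_continuous/linear_boundedP.
  move=> /pinfty_ex_gt0[r r0 br]; exists (complex.Re r).
    by move: r0; case: r {br} => a b; rewrite ltcE/= => /andP[_ /ltW].
  move=> x; have := br x; rewrite !normRE.
  move: r0; case: r {br} => a b; rewrite ltcE/= => /andP[/eqP-> _].
  by rewrite -[a +i* 0]/(a%:C) -rmorphM lecR.
move=> [K K0 bK]; split => //; have [f fA] := linear_pack linA.
rewrite fA; apply/linear_bounded_continuous/linear_boundedP.
exists K%:C; split; first by rewrite realE lecR K0.
move=> r Kr x; rewrite -fA (le_trans _ (ler_wpM2r _ (ltW Kr)))//.
by rewrite !normRE -rmorphM lecR.
Qed.

Lemma bounded_comp A B :
  bounded_operator A -> bounded_operator B -> bounded_operator (A \o B).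
Proof.
move=> /bounded_operatorP[lA [K K0 bA]] /bounded_operatorP[lB [L L0 bB]].
apply/bounded_operatorP; split.
  by move=> a x y /=; rewrite lB lA.
exists (K * L); first by rewrite mulr_ge0.
by move=> x /=; rewrite (le_trans (bA _))// -mulrA ler_wpM2l.
Qed.

Lemma bounded_lin2 (a b : R[i]) A B :
  bounded_operator A -> bounded_operator B ->
  bounded_operator (fun x => a *: A x + b *: B x).
Proof.
move=> [lA cA] [lB cB]; split.
  move=> c x y /=; rewrite lA lB !scalerDr !scalerA ![_ * c]mulrC.
  by rewrite addrACA -!scalerA.
by move=> x; apply: cvgD; apply: cvgZr; [exact: cA|exact: cB].
Qed.

(** Completeness of [H], with thresholds in [R] instead of [R[i]]. *)
Lemma complete_normR (u : nat -> H) :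
  (forall e : R, 0 < e -> exists N, forall n m, (N <= n)%N -> (N <= m)%N ->
     normR (u n - u m) <= e) ->
  exists l, forall e : R, 0 < e -> exists N, forall n, (N <= n)%N ->
     normR (u n - l) <= e.
Proof.
move=> cu.
have pos (e : R[i]) : 0 < e -> e = (complex.Re e)%:C /\ 0 < complex.Re e.
  by case: e => a b; rewrite ltcE/= => /andP[/eqP-> ->].
have /cvg_ex[l ul] : cvgn u.
  apply: cauchy_cvg; apply/cauchy_exP => e /pos[-> e0].
  have [N uN] := cu _ (divr_gt0 e0 (ltr0n R 2)).
  exists (u N); exists N => // n /= Nn; rewrite -ball_normE/= normRE ltcR.
  by rewrite (le_lt_trans (uN _ _ _ _))// ltr_pdivrMr// ltr_pMr// ltr1n.
exists l => e e0; have e0' : 0 < e%:C :> R[i] by rewrite ltcR.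
move/cvgrPdist_le: ul => /(_ _ e0')[N _ uN]; exists N => n Nn.
by have := uN _ Nn; rewrite normRE lecR normRBC.
Qed.

(** * Riesz representation and adjoints *)

(** The functional [J u = `|u|^2 - 2 f u] is bounded below. By the parallelogram
    identity its minimising sequences are Cauchy, and a minimiser [z] satisfies
    [f h = rdot h z] because the derivative of [J] at [z] along [h] vanishes. *)
Lemma lin_real_bounded_representable (f : H -> R) (K : R) :
  (forall (a : R) x y, f (a%:C *: x + y) = a * f x + f y) ->
  (forall x, `|f x| <= K * normR x) ->
  exists z, forall x, f x = rdot x z.
Proof.
move=> linf bf.
have fD x y : f (x + y) = f x + f y.
  by have := linf 1 x y; rewrite scale1r mul1r.
have f0 : f 0 = 0 
  by have := fD 0 0; rewrite addr0 => /eqP; rewrite addrC -subr_eq subrr => /eqP.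
have fZ (a : R) x : f (a%:C *: x) = a * f x by rewrite -[_ *: _]addr0 linf f0 addr0.
pose J u := normR u ^+ 2 - 2 * f u.
have Jlb u : - K ^+ 2 <= J u.
  rewrite /J; have := bf u; rewrite ler_norml => /andP[_ h].
  by have := sqr_ge0 (normR u - K); nra.
pose S := range J.
have infS : has_inf S.
  split; first by exists (J 0), 0.
  by exists (- K ^+ 2) => _ [u _ <-]; exact: Jlb.
pose m := inf S.
have mJ u : m <= J u by apply: ge_inf; [exact: infS.2|exists u].
pose iv (n : nat) : R := n.+1%:R^-1.
have iv_gt0 n : 0 < iv n by rewrite invr_gt0 ltr0n.
have inv_small (e : R) : 0 < e ->
    exists N, forall n, (N <= n)%N -> iv n <= e.
  move=> e0; exists (Num.bound e^-1) => n Nn.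
  rewrite /iv -[e]invrK lef_pV2 ?posrE ?invr_gt0 ?ltr0n//.
  rewrite (le_trans (ltW (archi_boundP _)))//; first by rewrite invr_ge0 ltW.
  by rewrite ler_nat leqW.
clearbody iv.
have /choice[u Ju] : forall n, exists u, J u < m + iv n.
  by move=> n; have [_ [u _ <-] Ju] := inf_adherent (iv_gt0 n) infS; exists u.
have half (x y : H) : normR (x - y) ^+ 2 <= 2 * (J x - m) + 2 * (J y - m).
  have := mJ ((2^-1)%:C *: (x + y)).
  rewrite /J fZ fD normRZ exprMn (sqr_normRD x y) sqr_normRB.
  rewrite ger0_norm ?invr_ge0// exprVn.
  have -> : 2 * (2^-1 * (f x + f y)) = f x + f y by field.
  by lra.
have [e e0|l ul] := @complete_normR u.
  have [|N hN] := inv_small (e ^+ 2 / 4); first by rewrite divr_gt0 ?exprn_gt0.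
  exists N => n k Nn Nk; rewrite -ler_sqr ?nnegrE ?normR_ge0 ?(ltW e0)//.
  have := half (u n) (u k); have := Ju n; have := Ju k.
  by have := hN _ Nn; have := hN _ Nk; lra.
exists l => h.
pose dl := rdot l h - f h; pose c := normR h ^+ 2.
have c0 : 0 <= c by rewrite sqr_ge0.
have crit (s : R) : 0 <= 2 * s * dl + s ^+ 2 * c.
  rewrite leNgt; apply/negP => neg.
  have [e eE] : exists e : R, e = - (2 * s * dl + s ^+ 2 * c) by eexists.
  have e0 : 0 < e by rewrite eE oppr_gt0.
  have [N1 hN1] := inv_small (e / 4) (divr_gt0 e0 (ltr0n R 4)).
  pose w := `|s| * normR h + 1.
  have w0 : 0 < w by rewrite ltr_wpDl// mulr_ge0// normR_ge0.
  have [|N2 hN2] := ul (e / 4 / w); first by rewrite !divr_gt0.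
  pose n := maxn N1 N2.
  have := mJ (u n + s%:C *: h); have := Ju n.
  have := hN1 n (leq_maxl _ _); have := hN2 n (leq_maxr _ _).
  rewrite ler_pdivlMr// => h2 h1.
  rewrite /J fD fZ sqr_normRD normRZ rdotZr exprMn real_normK ?num_real// -/c.
  have := CauchySchwarz (u n - l) (s%:C *: h).
  rewrite rdotDl rdotNl !rdotZr normRZ => cs.
  have : normR (u n - l) * (`|s| * normR h) <= e / 4.
    by apply: le_trans h2; rewrite ler_wpM2l ?normR_ge0// /w lerDl.
  move: cs eE h1; rewrite /dl; lra.
have dl0 : dl = 0.
  have [//|dlN0] := eqVneq dl 0.
  have d2 : 0 < dl ^+ 2 by rewrite exprn_even_gt0.
  (* At this s the linear term dominates the quadratic one if dl is nonzero. *)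
  have := crit (- dl / (c + 1)).
  have -> : 2 * (- dl / (c + 1)) * dl + (- dl / (c + 1)) ^+ 2 * c =
    - (dl ^+ 2 * (c + 2) / (c + 1) ^+ 2) by field; rewrite gt_eqF// ltr_wpDl.
  have pos : 0 < dl ^+ 2 * (c + 2) / (c + 1) ^+ 2.
    by rewrite divr_gt0 ?(mulr_gt0 d2)// ?exprn_gt0// ltr_wpDl.
  by rewrite oppr_ge0 leNgt pos.
by rewrite rdotC; apply/esym/eqP; rewrite -subr_eq0 -/dl dl0.
Qed.

Lemma adjoint_exists A : bounded_operator A ->
  exists B, bounded_operator B /\ forall x y, ip (A x) y = ip x (B y).
Proof.
move=> /bounded_operatorP[linA [K K0 bA]].
have /choice[B AB] : forall y, exists z, forall x, rdot (A x) y = rdot x z.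
  move=> y; apply: (@lin_real_bounded_representable _ (K * normR y)).
    by move=> a x x'; rewrite linA rdotDl rdotZl.
  move=> x; rewrite ler_norml lerNl -rdotNl; apply/andP; split.
    rewrite (le_trans (CauchySchwarz _ _))// normRN [leRHS]mulrAC ler_wpM2r ?normR_ge0//.
  by rewrite (le_trans (CauchySchwarz _ _))// [leRHS]mulrAC ler_wpM2r ?normR_ge0.
have ipAB x y : ip (A x) y = ip x (B y).
  by apply: rdot_ip => a; rewrite -linZ// AB.
exists B; split => //; apply/bounded_operatorP; split.
  move=> a x y; apply: rdot_sep => h.
  by rewrite /rdot -ipAB !linearDr !linearZr_LR/= !ipAB.
exists K => // y; have := AB y (B y); rewrite rdot_xx => e.
have [->|y0] := eqVneq (normR (B y)) 0; first by rewrite mulr_ge0 ?normR_ge0.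
have y1 : 0 < normR (B y) by rewrite lt_neqAle eq_sym y0 normR_ge0.
rewrite -(ler_pM2l y1) -expr2 -e (le_trans (CauchySchwarz _ _))//.
by rewrite mulrCA mulrA ler_wpM2r ?normR_ge0.
Qed.

Lemma adjointP A : bounded_operator A ->
  bounded_operator (adjoint ip A) /\
  forall x y, ip (A x) y = ip x (adjoint ip A y).
Proof. by move=> /adjoint_exists; exact: xgetPex. Qed.

Lemma rdot_adjoint A x y : bounded_operator A ->
  rdot (A x) y = rdot x (adjoint ip A y).
Proof. by move=> /adjointP[_ e]; rewrite /rdot e. Qed.

Lemma rdot_i x y : rdot x ('i *: y) = - rdot ('i *: x) y.
Proof.
rewrite (rdotC x) !rdotil opprK.
have Im_conj (a : R[i]) : complex.Im (Num.conj a) = - complex.Im a by case: a.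
by rewrite [ip x y]hermC expr0 mul1r; exact/esym/Im_conj.
Qed.

Definition selfadjoint A := forall x y, rdot (A x) y = rdot x (A y).

(** Polarisation: [ip (A x) x] is real for all [x], and the values of
    a sesquilinear form on a complex space are determined by its diagonal. *)
Lemma positive_selfadjoint A : positive_operator ip A -> selfadjoint A.
Proof.
move=> [[linA _] posA].
have sq x : rdot ('i *: A x) x = 0.
  by rewrite rdotil ger0_Im ?oppr0.
have pol x y : rdot ('i *: A x) y + rdot ('i *: A y) x = 0.
  have := sq (x + y); rewrite linD// scalerDr rdotDl !rdotDr !sq.
  by rewrite add0r addr0.
move=> x y; have := pol ('i *: x) y; rewrite linZ// scalerA rdot_i scalerA.
have -> : 'i * 'i = (-1)%:C :> R[i] by rewrite -expr2 sqr_i rmorphN1.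
rewrite !rdotZl !mulN1r opprK addrC => /eqP; rewrite subr_eq0 => /eqP <-.
by rewrite rdotC.
Qed.

(** * The operator norm *)

Lemma normR_opnorm A x : bounded_operator A ->
  normR (A x) <= opnorm A * normR x.
Proof.
move=> /bounded_operatorP[linA [K K0 bA]].
have [->|x0] := eqVneq x 0; first by rewrite lin0// normR0 mulr0.
have n0 : 0 < normR x by rewrite lt_neqAle eq_sym normR_eq0 x0 normR_ge0.
have nV : `|(normR x)^-1| * normR x = 1.
  by rewrite ger0_norm ?invr_ge0 ?normR_ge0// mulVf// gt_eqF.
rewrite -ler_pdivrMr// mulrC -[X in X * _]ger0_norm ?invr_ge0 ?normR_ge0//.
rewrite -normRZ -linZ//; apply: ub_le_sup; last first.
  by exists ((normR x)^-1%:C *: x) => //=; apply/normR_unit; rewrite normRZ.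
exists K => _ [y /= /normR_unit y1 <-].
by rewrite (le_trans (bA y))// y1 mulr1.
Qed.

Lemma opnorm_le A (K : R) : 0 <= K ->
  (forall x, normR (A x) <= K * normR x) -> opnorm A <= K.
Proof.
move=> K0 bA; rewrite /opnorm; set S := (X in sup X).
have [->|/set0P S0] := eqVneq S set0; first by rewrite sup0.
apply: ge_sup => // _ [x /= /normR_unit x1 <-].
by rewrite (le_trans (bA x))// x1 mulr1.
Qed.

Lemma opnorm_ge0 A : bounded_operator A -> 0 <= opnorm A.
Proof.
move=> bA; rewrite /opnorm; set S := (X in sup X).
have [->|/set0P[_ [x x1 _]]] := eqVneq S set0; first by rewrite sup0.
have := normR_opnorm x bA; move: x1 => /= /normR_unit->; rewrite mulr1.
by apply: le_trans; exact: normR_ge0.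
Qed.

(** * Polynomials in an operator *)

(** Complex coefficients are needed to split polynomials into linear factors. *)
Definition cpoly_op (q : {poly R[i]}) A : H -> H :=
  fun x => \sum_(k < size q) q`_k *: iter k A x.

Lemma cpoly_opE n (q : {poly R[i]}) A x : (size q <= n)%N ->
  cpoly_op q A x = \sum_(k < n) q`_k *: iter k A x.
Proof.
move=> qn; rewrite /cpoly_op (big_ord_widen n (fun k => q`_k *: iter k A x))//.
rewrite big_mkcond; apply: eq_bigr => k _; case: ltnP => // qk.
by rewrite nth_default// scale0r.
Qed.

Lemma poly_opE (p : {poly R}) A :
  poly_op p A = cpoly_op (map_poly (real_complex R) p) A.
Proof.
apply/funext => x; rewrite /poly_op /cpoly_op size_map_poly.
by apply: eq_bigr => k _; rewrite coef_map.
Qed.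

Lemma cpoly_opD p q A x :
  cpoly_op (p + q) A x = cpoly_op p A x + cpoly_op q A x.
Proof.
pose n := maxn (size p) (size q).
rewrite !(@cpoly_opE n) ?leq_maxl ?leq_maxr ?size_polyD// -big_split/=.
by apply: eq_bigr => k _; rewrite coefD scalerDl.
Qed.

Lemma cpoly_opC (c : R[i]) A x : cpoly_op c%:P A x = c *: x.
Proof. by rewrite (@cpoly_opE 1) ?size_polyC_leq1// big_ord1 coefC. Qed.

Lemma cpoly_opZ (c : R[i]) q A x : cpoly_op (c *: q) A x = c *: cpoly_op q A x.
Proof.
rewrite !(@cpoly_opE (size q)) ?size_scale_leq// scaler_sumr.
by apply: eq_bigr => k _; rewrite coefZ scalerA.
Qed.

Lemma cpoly_opMX q A x : cpoly_op (q * 'X) A x = cpoly_op q A (A x).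
Proof.
have sqX : (size (q * 'X)%R <= (size q).+1)%N.
  by rewrite (leq_trans (size_polyMleq _ _))// size_polyX addn2.
rewrite (cpoly_opE _ _ sqX).
rewrite big_ord_recl coefMX eqxx scale0r add0r.
by apply: eq_bigr => k _; rewrite coefMX lift0/= -iterS iterSr.
Qed.

Lemma cpoly_op_comm q A x : linear A -> cpoly_op q A (A x) = A (cpoly_op q A x).
Proof.
move=> linA; elim/poly_ind: q x => [|q c IH] x.
  by rewrite /cpoly_op size_poly0 !big_ord0 lin0.
by rewrite !cpoly_opD !cpoly_opMX !cpoly_opC linD// IH (linZ _ _ linA).
Qed.

Lemma cpoly_opM p q A x : linear A ->
  cpoly_op (p * q) A x = cpoly_op p A (cpoly_op q A x).
Proof.
move=> linA; elim/poly_ind: p x => [|p c IH] x.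
  by rewrite mul0r /cpoly_op size_poly0 !big_ord0.
rewrite mulrDl !cpoly_opD mulrAC !cpoly_opMX IH cpoly_op_comm//.
by rewrite mul_polyC cpoly_opZ cpoly_opC.
Qed.

Lemma poly_opM (p q : {poly R}) A x : linear A ->
  poly_op (p * q) A x = poly_op p A (poly_op q A x).
Proof. by move=> linA; rewrite !poly_opE rmorphM cpoly_opM. Qed.

Lemma poly_opB (p q : {poly R}) A x :
  poly_op (p - q) A x = poly_op p A x - poly_op q A x.
Proof.
rewrite !poly_opE rmorphB cpoly_opD; congr (_ + _).
by rewrite -scaleN1r cpoly_opZ scaleN1r.
Qed.

Lemma poly_opC (c : R) A x : poly_op c%:P A x = c%:C *: x.
Proof. by rewrite poly_opE map_polyC cpoly_opC. Qed.

Lemma poly_opX A x : poly_op 'X A x = A x.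
Proof.
by rewrite poly_opE map_polyX -['X]mul1r cpoly_opMX -polyC1 cpoly_opC scale1r.
Qed.

Lemma bounded_id : bounded_operator (id : H -> H).
Proof. by split=> // x; exact: cvg_id. Qed.

Lemma bounded_poly_op p A : bounded_operator A -> bounded_operator (poly_op p A).
Proof.
move=> bA.
have bI k : bounded_operator (iter k A).
  by elim: k => [|k IH]; [exact: bounded_id|exact: bounded_comp].
rewrite /poly_op; elim: (size p) => [|n IH].
  rewrite (_ : (fun x => _) = (fun x => 0 *: x + 0 *: x)).
    by apply: bounded_lin2; exact: bounded_id.
  by apply/funext => x; rewrite big_ord0 !scale0r addr0.
rewrite (_ : (fun x => _) =
    (fun x => 1 *: (\sum_(k < n) (p`_k)%:C *: iter k A x) +
              (p`_n)%:C *: iter n A x)); first exact: bounded_lin2.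
by apply/funext => x; rewrite big_ord_recr/= scale1r.
Qed.

Lemma selfadjoint_poly_op p A : selfadjoint A -> selfadjoint (poly_op p A).
Proof.
move=> sA x y; rewrite /poly_op rdot_suml rdot_sumr; apply: eq_bigr => k _.
rewrite rdotZl rdotZr; congr (_ * _).
by elim: (k : nat) x y => // n IH x y; rewrite iterS sA IH -iterSr.
Qed.

(** * The spectral bound *)

Section Spectral.
Context (A : H -> H) (bA : bounded_operator A) (pA : positive_operator ip A).
Let M := opnorm A.
Let linA : linear A := bA.1.
Let sA : selfadjoint A := positive_selfadjoint pA.

Let quad_ge0 x : 0 <= rdot (A x) x.
Proof.
have := pA.2 x; rewrite lecE => /andP[_]; exact.
Qed.

Let quad_le x : rdot (A x) x <= M * normR x ^+ 2.
Proof.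
rewrite (le_trans (CauchySchwarz _ _))// expr2 mulrA ler_wpM2r ?normR_ge0//.
exact: normR_opnorm.
Qed.

(** Pairing [A x - z x] with [x] or [-x] (if [z] is real), or with [+-'i x]
    (otherwise), gives at least [c `|x|^2], where [c] separates [z] from the
    numerical range of [A]; Cauchy-Schwarz concludes. *)
Lemma resolvent_lower (z : R[i]) : ~ (exists2 s : R, 0 <= s <= M & z = s%:C) ->
  exists2 c : R, 0 < c & forall x, c * normR x <= normR (A x - z *: x).
Proof.
have crit (c : R) x v : normR v = normR x ->
    c * normR x ^+ 2 <= rdot (A x - z *: x) v ->
    c * normR x <= normR (A x - z *: x).
  move=> vx h; have [->|x0] := eqVneq (normR x) 0.
    by rewrite mulr0 normR_ge0.
  have x1 : 0 < normR x by rewrite lt_neqAle eq_sym x0 normR_ge0.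
  rewrite -(ler_pM2r x1) -mulrA -expr2 (le_trans h)//.
  by rewrite (le_trans (CauchySchwarz _ _))// vx.
have normi x : normR ('i *: x) = normR x.
  by rewrite normRZC normc_def /= expr0n expr1n add0r sqrtr1 mul1r.
have xi x : rdot x ('i *: x) = 0 by have := rdot_i x x; rewrite [in RHS]rdotC; lra.
have Ai x : rdot (A x) ('i *: x) = 0.
  have : rdot (A x) ('i *: x) = - rdot (A x) ('i *: x).
    by rewrite [LHS]sA (linZ _ _ linA) rdot_i opprK rdotC.
  by lra.
case: z crit => a b crit nz.
have zE x : (a +i* b) *: x = a%:C *: x + b%:C *: ('i *: x).
  by rewrite [in LHS](complexE (a +i* b))/= scalerDl mulrC scalerA.
have dot_i x : rdot (A x - (a +i* b) *: x) ('i *: x) = - b * normR x ^+ 2.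
  rewrite zE rdotDl rdotNl rdotDl !rdotZl Ai xi rdot_xx normi; ring.
have [b0|b0|b0] := ltgtP b 0.
- exists (- b); first by rewrite oppr_gt0.
  by move=> x; apply: (crit _ _ ('i *: x)); rewrite ?normi// dot_i.
- exists b => // x; apply: (crit _ _ (- ('i *: x))); first by rewrite normRN normi.
  by rewrite rdotNr dot_i mulNr opprK.
have dot_x x : rdot (A x - (a +i* b) *: x) x = rdot (A x) x - a * normR x ^+ 2.
  by rewrite zE b0 scale0r addr0 rdotDl rdotNl rdotZl rdot_xx.
have [a0|a0] := ltP a 0.
  exists (- a); first by rewrite oppr_gt0.
  move=> x; apply: (crit _ _ x) => //; rewrite dot_x mulNr lerDr.
  exact: quad_ge0.
have [aM|aM] := leP a M.
  by case: nz; exists a; rewrite ?a0// b0.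
exists (a - M); first by rewrite subr_gt0.
move=> x; apply: (crit _ _ (- x)); first by rewrite normRN.
by rewrite rdotNr dot_x mulrBl; have := quad_le x; lra.
Qed.

(** The polynomial splits into linear factors, each bounded below by
    [resolvent_lower]. *)
Lemma cpoly_op_lower (q : {poly R[i]}) : q != 0 ->
  (forall s : R, 0 <= s <= M -> ~~ root q s%:C) ->
  exists2 c : R, 0 < c & forall x, c * normR x <= normR (cpoly_op q A x).
Proof.
have [r ->] := closed_field_poly_normal q.
set a := lead_coef q; rewrite scaler_eq0 negb_or => /andP[a0 _] nr.
have [c c0 hc] : exists2 c : R, 0 < c & forall x,
    c * normR x <= normR (cpoly_op (\prod_(z <- r) ('X - z%:P)) A x).
  have {}nr (s : R) : 0 <= s <= M -> s%:C \notin r.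
    by move=> /nr; rewrite rootZ// root_prod_XsubC.
  elim: r nr => [|z r IH] nr.
    exists 1 => // x; rewrite big_nil -polyC1 cpoly_opC scale1r mul1r//.
  have [s /nr|c c0 hc] := IH; first by rewrite inE negb_or => /andP[].
  have [[s /nr sM zs]|d d0 hd] := @resolvent_lower z.
    by move: sM; rewrite zs mem_head.
  exists (d * c); first by rewrite mulr_gt0.
  move=> x; rewrite big_cons cpoly_opM// -mulrA.
  rewrite (le_trans (ler_wpM2l (ltW d0) (hc x)))//.
  rewrite (le_trans (hd _))// cpoly_opD -polyCN cpoly_opC scaleNr.
  by rewrite -['X]mul1r cpoly_opMX -polyC1 cpoly_opC scale1r.
have a_gt0 : 0 < complex.Re `|a| by move: a0; rewrite -normr_gt0 ltcE => /andP[].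
exists (complex.Re `|a| * c); first exact: mulr_gt0.
move=> x; rewrite cpoly_opZ normRZC -mulrA ler_wpM2l//; exact: ltW.
Qed.

(** If [l = `|p(A)|] exceeded [C], then [p^2 - l^2] would have no root in
    [[0, `|A|]], and [p(A)^2 - l^2] would be bounded below. But
    [`|S^2 y - l^2 y|^2 <= l^2 (l^2 `|y|^2 - `|S y|^2)] for [S = p(A)], so that
    [`|S y| / `|y|] would stay away from its supremum [l]. *)
Lemma poly_op_bound (p : {poly R}) (C : R) : 0 <= C ->
  (forall s : R, 0 <= s <= M -> `|p.[s]| <= C) ->
  forall x, normR (poly_op p A x) <= C * normR x.
Proof.
move=> C0 hp x.
have bS := bounded_poly_op p bA; set S := poly_op p A in bS *.
have sS : selfadjoint S by exact: selfadjoint_poly_op.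
pose l := opnorm S.
suff lC : l <= C.
  by rewrite (le_trans (normR_opnorm x bS))// ler_wpM2r ?normR_ge0.
rewrite leNgt; apply/negP => Cl; have l0 : 0 < l by exact: le_lt_trans Cl.
pose q := (p ^+ 2 - (l ^+ 2)%:P) : {poly R}.
have qlt (s : R) : 0 <= s <= M -> q.[s] < 0.
  move=> /hp ps; rewrite !hornerE subr_lt0 -real_normK ?num_real//.
  by rewrite ltr_sqr ?nnegrE ?normr_ge0 ?(ltW l0)// (le_lt_trans ps).
have M0 : (0 : R) <= 0 <= M by rewrite lexx opnorm_ge0.
have [||c c0 hc] := @cpoly_op_lower (map_poly (real_complex R) q).
- rewrite map_poly_eq0; apply/eqP => q0; have := qlt 0 M0.
  by rewrite q0 horner0 ltxx.
- move=> s /qlt qs; rewrite /root horner_map/= fmorph_eq0 lt_eqF//.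
have hS y : c ^+ 2 * normR y ^+ 2 <=
    l ^+ 2 * (l ^+ 2 * normR y ^+ 2 - normR (S y) ^+ 2).
  have := hc y; rewrite -poly_opE poly_opB expr2 poly_opM// poly_opC -/S => h.
  have : (c * normR y) ^+ 2 <= normR (S (S y) - (l ^+ 2)%:C *: y) ^+ 2.
    by rewrite ler_sqr ?nnegrE ?normR_ge0// mulr_ge0 ?normR_ge0// ltW.
  rewrite sqr_normRB rdotZr -[rdot (S (S y)) y]rdotC -sS rdot_xx normRZ.
  rewrite (ger0_norm (sqr_ge0 l)).
  have : normR (S (S y)) ^+ 2 <= (l * normR (S y)) ^+ 2.
    rewrite ler_sqr ?nnegrE ?normR_ge0 ?mulr_ge0 ?normR_ge0 ?(ltW l0)//.
    exact: normR_opnorm.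
  rewrite !exprMn; lra.
pose k := Num.max 0 (l ^+ 2 - c ^+ 2 / l ^+ 2).
have k0 : 0 <= k by rewrite le_max lexx.
have hk y : normR (S y) <= Num.sqrt k * normR y.
  rewrite -ler_sqr ?nnegrE ?normR_ge0 ?mulr_ge0 ?sqrtr_ge0 ?normR_ge0//.
  rewrite exprMn sqr_sqrtr//.
  rewrite (@le_trans _ _ ((l ^+ 2 - c ^+ 2 / l ^+ 2) * normR y ^+ 2))//.
    have := hS y; rewrite -ler_pdivrMl ?exprn_gt0// mulrA [_^-1 * _]mulrC; lra.
  by rewrite ler_wpM2r ?sqr_ge0// le_max lexx orbT.
have := opnorm_le (sqrtr_ge0 k) hk; rewrite -/l leNgt => /negP; apply.
rewrite -ltr_sqr ?nnegrE ?sqrtr_ge0 ?(ltW l0)// sqr_sqrtr// gt_max exprn_gt0//=.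
by rewrite gtrBl divr_gt0// exprn_gt0.
Qed.

(** * The functional calculus of a positive operator *)

Local Notation is_fc f B := (is_functional_calculus f A B).

Lemma normR_small x (C : R) :
  (forall e : R, 0 < e -> e <= 1 -> normR x <= e * C) -> x = 0.
Proof.
move=> h; apply/eqP; rewrite -normR_eq0 eq_le normR_ge0 andbT leNgt.
apply/negP => x0; pose D := Num.max C 1.
have D0 : 0 < D by rewrite lt_max ltr01 orbT.
pose e := Num.min 1 (normR x / 2 / D).
have e0 : 0 < e by rewrite lt_min ltr01 !divr_gt0.
have := h e e0; rewrite ge_min lexx => /(_ isT).
have eD : e * D <= normR x / 2 by rewrite -ler_pdivlMr// ge_min lexx orbT.
have : e * C <= e * D by rewrite ler_wpM2l ?(ltW e0)// le_max lexx.
lra.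
Qed.

Lemma bounded_sub B C : bounded_operator B -> bounded_operator C ->
  bounded_operator (B - C).
Proof.
move=> bB bC; rewrite (_ : B - C = fun x => 1 *: B x + (-1) *: C x).
  exact: bounded_lin2.
by apply/funext => x; rewrite scale1r scaleN1r.
Qed.

Lemma fc_approx f B (e : R) : is_fc f B -> 0 < e -> exists p : {poly R},
  (forall s : R, 0 <= s <= M -> `|p.[s] - f s| <= e) /\
  forall x, normR (poly_op p A x - B x) <= e * normR x.
Proof.
move=> [bB [p [unif cvgp]]] e0.
have [N1 _ hN1] := unif e e0.
move/cvgrPdist_le : cvgp => /(_ e e0)[N2 _ hN2].
exists (p (maxn N1 N2)); split; first by apply: hN1; exact: leq_maxl.
move=> x; have := hN2 (maxn N1 N2) (leq_maxr _ _).
have bd := bounded_sub (bounded_poly_op (p (maxn N1 N2)) bA) bB.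
rewrite sub0r normrN ger0_norm ?opnorm_ge0// => h.
by rewrite (le_trans (normR_opnorm x bd))// ler_wpM2r ?normR_ge0.
Qed.

(** By the spectral bound, uniform convergence of [p n] on [[0, `|A|]] makes the
    operators [p n (A)] a Cauchy sequence in norm. *)
Lemma fc_exists (f : R -> R) (p : nat -> {poly R}) :
  (forall e : R, 0 < e -> exists N, forall n, (N <= n)%N ->
    forall s, 0 <= s <= M -> `|(p n).[s] - f s| <= e) ->
  exists B, is_fc f B.
Proof.
move=> unif.
have cauchy (e : R) : 0 < e -> exists N, forall n m, (N <= n)%N -> (N <= m)%N ->
    forall x, normR (poly_op (p n) A x - poly_op (p m) A x) <= e * normR x.
  move=> e0; have [N hN] := unif (e / 2) (divr_gt0 e0 (ltr0n R 2)).
  exists N => n m Nn Nm x; rewrite -poly_opB.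
  apply: poly_op_bound; first exact: ltW.
  move=> s s01; rewrite !hornerE.
  have := hN n Nn s s01; have := hN m Nm s s01.
  by rewrite !ler_norml; lra.
have /choice[B hB] : forall x, exists l, forall e : R, 0 < e -> exists N,
    forall n, (N <= n)%N -> normR (poly_op (p n) A x - l) <= e.
  move=> x; apply: complete_normR => e e0.
  have x1 : 0 < normR x + 1 by rewrite ltr_wpDl ?normR_ge0.
  have [N hN] := cauchy _ (divr_gt0 e0 x1); exists N => n m Nn Nm.
  rewrite (le_trans (hN _ _ Nn Nm x))// mulrAC ler_pdivrMr// ler_wpM2l ?(ltW e0)//.
  by rewrite lerDl.
have unifB (e : R) : 0 < e -> exists N, forall n, (N <= n)%N ->
    forall x, normR (poly_op (p n) A x - B x) <= e * normR x.
  move=> e0; have [N hN] := cauchy e e0; exists N => n Nn x.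
  apply/ler_addgt0Pr => d d0; have [N' hN'] := hB x d d0.
  pose m := maxn N N'.
  rewrite -[poly_op (p n) A x](subrK (poly_op (p m) A x)) -addrA.
  rewrite (le_trans (normRD _ _))// lerD//.
    by apply: hN => //; exact: leq_maxl.
  by apply: hN'; exact: leq_maxr.
have linBB : linear B.
  move=> a x y; apply/eqP; rewrite -subr_eq0; apply/eqP.
  apply: (@normR_small _
    (normR (a *: x + y) + (complex.Re `|a| * normR x + normR y))) => e e0 _.
  have [N hN] := unifB e e0; have hx := hN N (leqnn N).
  apply: le_trans (normR_tri _ (poly_op (p N) A (a *: x + y)) _) _.
  rewrite mulrDr lerD//; first by rewrite normRBC hx.
  rewrite (bounded_poly_op (p N) bA).1 opprD addrACA -scalerBr.
  rewrite (le_trans (normRD _ _))// mulrDr lerD// normRZC mulrCA ler_wpM2l//.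
  by have := normr_ge0 a; rewrite lecE => /andP[].
have bB : bounded_operator B.
  apply/bounded_operatorP; split => //.
  have [N hN] := unifB 1 ltr01.
  have /bounded_operatorP[_ [K K0 hK]] := bounded_poly_op (p N) bA.
  exists (K + 1); first by rewrite addr_ge0.
  move=> x; rewrite -[B x](subKr (poly_op (p N) A x)) mulrDl.
  by rewrite (le_trans (normRB _ _))// lerD// hN.
exists B; split => //; exists p; split => [e e0|].
  by have [N hN] := unif e e0; exists N.
apply/cvgrPdist_le => e e0; have [N hN] := unifB e e0; exists N => // n /= Nn.
have bd := bounded_sub (bounded_poly_op (p n) bA) bB.
rewrite sub0r normrN ger0_norm ?opnorm_ge0//; apply: opnorm_le; first exact: ltW.
exact: hN.
Qed.

Lemma fc_poly (p : {poly R}) : is_fc (fun s => p.[s]) (poly_op p A).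
Proof.
split; first exact: bounded_poly_op.
exists (fun=> p); split => [e e0|].
  by exists 0%N => // n _ s _; rewrite subrr normr0 ltW.
rewrite (_ : opnorm _ = 0); first exact: cvg_cst.
apply/eqP; rewrite eq_le opnorm_ge0 ?andbT.
  by apply: opnorm_le => // x; rewrite /= subrr normR0 mul0r.
by apply: bounded_sub; exact: bounded_poly_op.
Qed.

Lemma fc_bound f B (C : R) : is_fc f B ->
  (forall s : R, 0 <= s <= M -> `|f s| <= C) ->
  forall x, normR (B x) <= C * normR x.
Proof.
move=> fB fC x.
have M0 : (0 : R) <= 0 <= M by rewrite lexx opnorm_ge0.
have C0 : 0 <= C := le_trans (normr_ge0 _) (fC 0 M0).
apply/ler_addgt0Pr => d d0.
pose e := d / 2 / (normR x + 1).
have x1 : 0 < normR x + 1 by rewrite ltr_wpDl ?normR_ge0.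
have e0 : 0 < e by rewrite !divr_gt0.
have ex : e * normR x <= d / 2.
  by rewrite mulrAC ler_pdivrMr// ler_wpM2l ?lerDl// ltW// divr_gt0.
have [p [pf pB]] := fc_approx fB e0.
have pb : normR (poly_op p A x) <= (C + e) * normR x.
  apply: poly_op_bound => [|s sM]; first by rewrite addr_ge0// ltW.
  have := pf s sM; have := fC s sM; rewrite !ler_norml; lra.
rewrite -[B x](subKr (poly_op p A x)) (le_trans (normRB _ _))//.
have := pB x; lra.
Qed.

Lemma fc_selfadjoint f B : is_fc f B -> selfadjoint B.
Proof.
move=> fB x y; apply/eqP; rewrite -subr_eq0 -normr_eq0 eq_le normr_ge0 andbT.
apply/ler_addgt0Pr => d d0; rewrite add0r.
pose w := 2 * (normR x * normR y) + 1.
have w0 : 0 < w by rewrite ltr_wpDl// mulr_ge0// mulr_ge0 ?normR_ge0.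
pose e := d / w; have e0 : 0 < e by rewrite divr_gt0.
have ew : e * (normR x * normR y) * 2 <= d.
  have : e * w = d by rewrite divfK// gt_eqF.
  by rewrite /w; have := e0; nra.
have [p [_ pB]] := fc_approx fB e0.
have sp := @selfadjoint_poly_op p A sA x y.
have small u v : `|rdot (poly_op p A u - B u) v| <= e * (normR u * normR v).
  have pu : normR (poly_op p A u - B u) * normR v <= e * (normR u * normR v).
    by rewrite mulrA ler_wpM2r ?normR_ge0.
  rewrite ler_norml lerNl -rdotNl !(le_trans (CauchySchwarz _ _)) ?normRN//.
have := small x y; have := small y x.
rewrite !rdotDl !rdotNl [rdot (B y) x]rdotC [rdot (poly_op p A y) x]rdotC sp.
by rewrite [normR y * _]mulrC !ler_norml; move: ew; lra.
Qed.

(** If [p], [q], [r] approximate [f], [g] and [h = f g] uniformly, then [p q - r]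
    is uniformly small, and so is [p(A) q(A) - r(A)] by the spectral bound. *)
Lemma fc_mul f g h B C D (F : R) :
  is_fc f B -> is_fc g C -> is_fc h D ->
  (forall s : R, 0 <= s <= M ->
     [/\ `|f s| <= F, `|g s| <= F & h s = f s * g s]) ->
  D = B \o C.
Proof.
move=> fB gC hD fgh; apply/funext => x /=.
apply/eqP; rewrite -subr_eq0; apply/eqP.
have M0 : (0 : R) <= 0 <= M by rewrite lexx opnorm_ge0.
have F0 : 0 <= F by have [+ _ _] := fgh 0 M0; exact: le_trans.
(* The summands bound, in this order and up to the factor e, the four distances
   of the chain D x, r(A) x, p(A) q(A) x, B (q(A) x), B (C x). *)
apply: (@normR_small _ ((1 + (2 * F + 2) + (F + 1) + F) * normR x)) => e e0 e1.
have [p [pf pB]] := fc_approx fB e0.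
have [q [qg qC]] := fc_approx gC e0.
have [r [rh rD]] := fc_approx hD e0.
have bF : forall y, normR (B y) <= F * normR y.
  by apply: fc_bound fB _ => s /fgh[].
have linBB := fB.1.1.
pose P := poly_op p A; pose Q := poly_op q A; pose S := poly_op r A.
have h1 : normR (S x - D x) <= e * normR x := rD x.
have h2 : normR (S x - P (Q x)) <= (e * (2 * F + 2)) * normR x.
  rewrite /S /P /Q -(poly_opM _ _ _ linA) -poly_opB; apply: poly_op_bound.
    by rewrite mulr_ge0// ?(ltW e0)// addr_ge0// mulr_ge0.
  move=> s sM; rewrite hornerD hornerN hornerM; have [fs gs hs] := fgh s sM.
  have := pf s sM; have := qg s sM; have := rh s sM; rewrite hs => rs qs ps.
  have -> : r.[s] - p.[s] * q.[s] =
      (r.[s] - f s * g s) - (p.[s] - f s) * (q.[s] - g s)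
      - f s * (q.[s] - g s) - g s * (p.[s] - f s) by ring.
  have m1 : `|(p.[s] - f s) * (q.[s] - g s)| <= e * 1.
    by rewrite normrM ler_pM// (le_trans qs).
  have m2 : `|f s * (q.[s] - g s)| <= F * e by rewrite normrM ler_pM.
  have m3 : `|g s * (p.[s] - f s)| <= F * e by rewrite normrM ler_pM.
  have tri (a b c d : R) : `|a| <= e -> `|b| <= e * 1 -> `|c| <= F * e ->
      `|d| <= F * e -> `|a - b - c - d| <= e * (2 * F + 2).
    by rewrite !ler_norml; lra.
  exact: tri.
have hQ : normR (Q x) <= (F + 1) * normR x.
  apply: poly_op_bound; first by rewrite addr_ge0.
  move=> s sM; have [_ gs _] := fgh s sM; have := qg s sM.
  by move: gs; rewrite !ler_norml; lra.
have h3 : normR (P (Q x) - B (Q x)) <= e * ((F + 1) * normR x) :=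
  le_trans (pB (Q x)) (ler_wpM2l (ltW e0) hQ).
have h4 : normR (B (Q x - C x)) <= F * (e * normR x) :=
  le_trans (bF (Q x - C x)) (ler_wpM2l F0 (qC x)).
have t1 := normR_tri (D x) (S x) (B (C x)).
have t2 := normR_tri (S x) (P (Q x)) (B (C x)).
have t3 := normR_tri (P (Q x)) (B (Q x)) (B (C x)).
rewrite -(linB _ _ linBB) in t3.
by move: t1 t2 t3 h1 h2 h3 h4; rewrite (normRBC (D x) (S x)); lra.
Qed.

Lemma fc_unique f B C : is_fc f B -> is_fc f C ->
  (exists F : R, forall s : R, 0 <= s <= M -> `|f s| <= F) -> B = C.
Proof.
move=> fB fC [F hF].
rewrite (@fc_mul f (fun s => (1 : {poly R}).[s]) f C (poly_op 1 A) B
  (Num.max F 1))//.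
- by apply/funext => x /=; rewrite -polyC1 poly_opC scale1r.
- exact: fc_poly.
- move=> s sM; rewrite hornerE normr1 mulr1 le_max hF//.
  by rewrite le_max lexx orbT.
Qed.

Lemma powR_bound (t s : R) : 0 <= t <= 1 -> 0 <= s <= M -> `|s `^ t| <= M + 1.
Proof.
move=> /andP[t0 t1] /andP[s0 sM]; rewrite ger0_norm ?powR_ge0//.
rewrite (@le_trans _ _ ((M + 1) `^ t))//.
  by rewrite ge0_ler_powR ?nnegrE ?(le_trans sM) ?lerDl// addr_ge0// (le_trans s0).
by rewrite ler1_powR// lerDr (le_trans s0).
Qed.

Lemma op_powP (t : R) : 0 <= t <= 1 -> is_fc (fun s => s `^ t) (op_pow A t).
Proof.
move=> t01.
suff : exists B, is_fc (fun s => s `^ t) B by exact: xgetPex.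
have [p hp] := powR_approx t01 (opnorm_ge0 bA).
exact: fc_exists hp.
Qed.

Lemma op_pow_bound (t : R) x : 0 <= t <= 1 ->
  normR (op_pow A t x) <= (M + 1) * normR x.
Proof. by move=> t01; apply: fc_bound (op_powP t01) _ _ => s; exact: powR_bound. Qed.

Lemma op_pow_bounded (t : R) : 0 <= t <= 1 -> bounded_operator (op_pow A t).
Proof. by case/op_powP. Qed.

Lemma op_powD (s t : R) : 0 <= s -> 0 <= t -> s + t <= 1 ->
  op_pow A (s + t) = op_pow A s \o op_pow A t.
Proof.
move=> s0 t0 st.
apply: (fc_mul (op_powP _) (op_powP _) (op_powP _) (F := M + 1)); try lra.
move=> u uM; split; try by apply: powR_bound => //; lra.
(* At u = 0 the convention that 0 to the power 0 is 1 has to be respected. *)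
have [->|uN0] := eqVneq u 0; last by rewrite powRD// uN0 implybT.
have [->|sN0] := eqVneq s 0; first by rewrite add0r powRr0 mul1r.
by rewrite (powR0 sN0) mul0r powR0// gt_eqF// ltr_pwDl// lt_neqAle eq_sym sN0.
Qed.

Lemma op_pow0 : op_pow A 0 = id.
Proof.
apply: (@fc_unique (fun s => s `^ 0)).
- by apply: op_powP; rewrite lexx ler01.
- rewrite (_ : id = poly_op 1 A).
    rewrite (_ : (fun s => _) = fun s => (1 : {poly R}).[s]); first exact: fc_poly.
    by apply/funext => s; rewrite powRr0 hornerE.
  by apply/funext => x; rewrite -polyC1 poly_opC scale1r.
- by exists (M + 1) => s; apply: powR_bound; rewrite lexx ler01.
Qed.

Lemma op_pow1 : op_pow A 1 = A.
Proof.
have AX : A = poly_op 'X A by apply/funext => x; rewrite poly_opX.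
have t1 : 0 <= (1 : R) <= 1 by rewrite ler01 lexx.
rewrite [RHS]AX (fc_mul (op_powP t1) (fc_poly 1) (fc_poly 'X) (F := M + 1)).
  by apply/funext => x /=; rewrite -polyC1 poly_opC scale1r.
move=> s sM; split; first exact: powR_bound.
  by rewrite hornerE normr1 lerDr opnorm_ge0.
by rewrite !hornerE powRr1//; case/andP: sM.
Qed.

End Spectral.

(** * Joint norms of tuples *)

Section Tuples.
Context (d : nat).
Implicit Types (T Z : 'I_d -> H -> H).

Lemma joint_norm_le T (c : R) : 0 <= c ->
  (forall x, \sum_k normR (T k x) ^+ 2 <= (c * normR x) ^+ 2) -> joint_norm T <= c.
Proof.
move=> c0 hT; rewrite /joint_norm; set S := (X in sup X).
have [->|/set0P S0] := eqVneq S set0; first by rewrite sup0.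
apply: ge_sup => // _ [x /= /normR_unit x1 <-].
have := hT x; rewrite x1 mulr1 => h.
by rewrite -(ger0_norm c0) -sqrtr_sqr ler_wsqrtr.
Qed.

Lemma joint_normP T : (forall k, bounded_operator (T k)) ->
  0 <= joint_norm T /\
  forall x, \sum_k normR (T k x) ^+ 2 <= (joint_norm T * normR x) ^+ 2.
Proof.
move=> bT.
have unit_le x : normR x = 1 -> Num.sqrt (\sum_k normR (T k x) ^+ 2) <= joint_norm T.
  move=> /normR_unit x1; apply: ub_le_sup; last by exists x.
  exists (Num.sqrt (\sum_k opnorm (T k) ^+ 2)) => _ [y /= /normR_unit y1 <-].
  rewrite ler_wsqrtr//; apply: ler_sum => k _.
  rewrite ler_sqr ?nnegrE ?normR_ge0 ?opnorm_ge0//.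
  by have := normR_opnorm y (bT k); rewrite y1 mulr1.
have norm1 x : x != 0 -> normR ((normR x)^-1%:C *: x) = 1.
  rewrite -normR_eq0 => x0.
  by rewrite normRZ ger0_norm ?invr_ge0 ?normR_ge0// mulVf.
have jn0 : 0 <= joint_norm T.
  have [[x x0]|/forallNP h] := pselect (exists x : H, x != 0).
    by apply: le_trans (unit_le _ (norm1 x x0)); exact: sqrtr_ge0.
  rewrite /joint_norm (_ : [set _ | _ in _] = set0) ?sup0//.
  apply/seteqP; split => // _ [x /= x1 _]; have := h x; apply.
  by rewrite -normr_eq0 x1 oner_eq0.
split => // x; have [->|x0] := eqVneq x 0.
  rewrite big1 ?sqr_ge0// => k _; rewrite lin0 ?normR0 ?expr0n//.
  by case: (bT k).
have n0 : 0 < normR x by rewrite lt_neqAle eq_sym normR_eq0 x0 normR_ge0.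
have := unit_le _ (norm1 x x0).
rewrite -ler_sqr ?nnegrE ?sqrtr_ge0// sqr_sqrtr ?sumr_ge0// => [ux|k _];
  last exact: sqr_ge0.
rewrite exprMn -[leLHS](divfK (lt0r_neq0 (exprn_gt0 2 n0))) ler_wpM2r ?sqr_ge0//.
apply: le_trans ux; rewrite mulr_suml; apply: ler_sum => k _.
rewrite (linZ _ _ (bT k).1) normRZ exprMn mulrC.
by rewrite ger0_norm ?invr_ge0 ?normR_ge0// exprVn.
Qed.

(** * The operator arithmetic-geometric mean inequality *)

Lemma joint_norm_almost_attained T (eta : R) : (forall k, bounded_operator (T k)) ->
  0 < eta -> eta <= joint_norm T -> exists u,
  (joint_norm T ^+ 2 - eta ^+ 2) * normR u ^+ 2 < \sum_k normR (T k u) ^+ 2.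
Proof.
move=> bT e0 el; apply/not_existsP => h; set l := joint_norm T in el h *.
have l0 : 0 <= l by rewrite (le_trans (ltW e0)).
have k0 : 0 <= l ^+ 2 - eta ^+ 2.
  by rewrite subr_ge0 ler_sqr ?nnegrE// ltW.
have : l <= Num.sqrt (l ^+ 2 - eta ^+ 2).
  apply: joint_norm_le; first exact: sqrtr_ge0.
  by move=> x; rewrite exprMn sqr_sqrtr// leNgt; apply/negP/h.
rewrite -ler_sqr ?nnegrE ?sqrtr_ge0// sqr_sqrtr//.
by have := exprn_gt0 2 e0; lra.
Qed.

(** Let [S = A Z A], [l = `|S|], and let [u] almost attain [l], so that
    [v = S u] satisfies [S^* v = l^2 u + e] with [e] small. For [y = A u] and
    [w = A v] this gives [<(A^2 Z + Z A^2) y, w> = `|w|^2 + l^2 `|y|^2 + <A y, e>],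
    whereas the hypothesis bounds the left-hand side by
    [2 N `|y| `|w| <= (N / l) (`|w|^2 + l^2 `|y|^2)]. As [y] does not tend to
    [0] with [e], [N < l] is impossible. *)
Lemma operator_am_gm A Z (N : R) :
  bounded_operator A -> selfadjoint A -> (forall k, bounded_operator (Z k)) ->
  0 <= N ->
  (forall x, \sum_k normR (A (A (Z k x)) + Z k (A (A x))) ^+ 2 <=
     (2 * N * normR x) ^+ 2) ->
  joint_norm (fun k => A \o Z k \o A) <= N.
Proof.
move=> bA sA bZ N0 hN.
have bAZ k : bounded_operator (A \o Z k) by exact: bounded_comp.
have bS k : bounded_operator (A \o Z k \o A) by exact: bounded_comp.
set S := fun k => A \o Z k \o A; pose l := joint_norm S.
have [l0 hl] := joint_normP bS; rewrite -/S -/l in l0 hl.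
have [L0 hL] := joint_normP bAZ; set L := joint_norm _ in L0 hL.
pose K := opnorm A; have K0 : 0 <= K := opnorm_ge0 bA.
rewrite leNgt; apply/negP => Nl; rewrite -/S -/l in Nl.
have {}l0 : 0 < l by exact: le_lt_trans Nl.
have lN : 0 < l - N by rewrite subr_gt0.
(* The first bound keeps y away from 0, the second contradicts N < l at the end. *)
pose eta := Num.min (l / 2) ((l - N) * l / 4 / (L * K + 1)).
have LK0 : 0 <= L * K by rewrite mulr_ge0.
have LK1 : 0 < L * K + 1 by rewrite ltr_wpDl.
have e0 : 0 < eta by rewrite lt_min !divr_gt0 ?mulr_gt0.
have el2 : eta <= l / 2 by rewrite ge_min lexx.
have eLK : eta * (L * K + 1) <= (l - N) * l / 4.
  by rewrite -ler_pdivlMr// ge_min lexx orbT.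
have [|u hu] := joint_norm_almost_attained bS e0; first by rewrite -/S -/l; lra.
rewrite -/S -/l in hu; set sg := \sum_k _ in hu.
pose n := normR u; have n0 : 0 <= n := normR_ge0 u.
pose v k := S k u; pose y := A u; pose w k := A (v k).
pose Za k := adjoint ip (Z k).
pose g := \sum_k Za k (w k).
have Zg x : rdot x g = \sum_k rdot (Z k x) (w k).
  by rewrite rdot_sumr; apply: eq_bigr => k _; rewrite rdot_adjoint.
have Ag x : rdot x (A g) = \sum_k rdot (S k x) (v k).
  by rewrite -sA Zg; apply: eq_bigr => k _; rewrite -sA.
have sg_n : sg <= (l * n) ^+ 2 := hl u.
have sg0 : 0 <= sg by apply: sumr_ge0 => k _; exact: sqr_ge0.
have Agu : rdot u (A g) = sg.
  by rewrite Ag; apply: eq_bigr => k _; rewrite rdot_xx.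
have Ag_norm : normR (A g) ^+ 2 <= l ^+ 2 * sg.
  have : normR (A g) ^+ 2 <= (l * normR (A g)) * Num.sqrt sg.
    rewrite -rdot_xx Ag; apply: CauchySchwarz_family; rewrite ?sqrtr_ge0//.
    - by rewrite mulr_ge0 ?normR_ge0// ltW.
    - exact: hl.
    - by rewrite sqr_sqrtr.
  have [->|z0] := eqVneq (normR (A g)) 0.
    by move=> _; rewrite expr0n/= mulr_ge0 ?sqr_ge0.
  have z1 : 0 < normR (A g) by rewrite lt_neqAle eq_sym z0 normR_ge0.
  rewrite expr2 mulrAC ler_pM2r// => h.
  rewrite -[sg in leRHS]sqr_sqrtr// -exprMn ler_sqr ?nnegrE ?normR_ge0//.
  by rewrite mulr_ge0 ?sqrtr_ge0// ltW.
pose e := A g - (l ^+ 2)%:C *: u.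
have e_norm : normR e <= l * eta * n.
  rewrite -ler_sqr ?nnegrE ?normR_ge0 ?mulr_ge0 ?(ltW l0) ?(ltW e0)//.
  rewrite /e sqr_normRB rdotZr normRZ exprMn real_normK ?num_real//.
  rewrite [rdot (A g) u]rdotC Agu -/n.
  have : l ^+ 2 * ((l ^+ 2 - eta ^+ 2) * n ^+ 2) <= l ^+ 2 * sg.
    by rewrite ler_wpM2l ?sqr_ge0// ltW.
  by move: Ag_norm; lra.
pose ny := normR y; have ny0 : 0 <= ny := normR_ge0 y.
pose om := Num.sqrt (\sum_k normR (w k) ^+ 2).
have om0 : 0 <= om by exact: sqrtr_ge0.
have omE : \sum_k normR (w k) ^+ 2 = om ^+ 2.
  by rewrite sqr_sqrtr// sumr_ge0// => k _; exact: sqr_ge0.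
have main : om ^+ 2 + l ^+ 2 * ny ^+ 2 + rdot (A y) e <= 2 * N * ny * om.
  have := @CauchySchwarz_family d (fun k => A (A (Z k y)) + Z k (A (A y))) w
    (2 * N * ny) om.
  rewrite omE lexx !mulr_ge0// => /(_ isT om0 (hN y) isT); apply: le_trans.
  rewrite (eq_bigr (fun k => normR (w k) ^+ 2 + rdot (Z k (A (A y))) (w k))).
    rewrite big_split/= omE -Zg [rdot _ g]sA -addrA lerD2l.
    by rewrite /e rdotDr rdotNr rdotZr [rdot _ u]sA -/y rdot_xx addrC subrK.
  by move=> k _; rewrite rdotDl rdot_xx.
have cross : - (K * ny * (l * eta * n)) <= rdot (A y) e.
  rewrite lerNl -rdotNr (le_trans (CauchySchwarz _ _))// normRN.
  by apply: ler_pM; rewrite ?normR_ge0// normR_opnorm.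
have Ly : sg <= (L * ny) ^+ 2 := hL y.
have en : eta ^+ 2 <= l ^+ 2 / 4.
  have -> : l ^+ 2 / 4 = (l / 2) ^+ 2 by field.
  by rewrite ler_sqr ?nnegrE ?(ltW e0)// divr_ge0// ltW.
have n1 : 0 < n.
  rewrite lt_neqAle n0 andbT; apply/eqP => n00.
  by move: hu sg_n; rewrite -/n -n00 expr0n !mulr0 expr0n /=; lra.
have nLy : l / 2 * n <= L * ny.
  rewrite -ler_sqr ?nnegrE ?mulr_ge0// ?divr_ge0 ?(ltW l0)//.
  apply: le_trans Ly; apply: le_trans (ltW hu).
  rewrite -/n exprMn ler_wpM2r ?sqr_ge0//.
  have -> : (l / 2) ^+ 2 = l ^+ 2 / 4 by field.
  by have := sqr_ge0 l; move: en; lra.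
have ny1 : 0 < ny.
  rewrite lt_neqAle ny0 andbT; apply/eqP => ny00.
  have : 0 < l / 2 * n by rewrite mulr_gt0// divr_gt0.
  by move: nLy; rewrite -ny00 mulr0; lra.
have step : (l - N) * ny <= K * eta * n.
  have amgm : 2 * N * ny * om * l <= N * (om ^+ 2 + l ^+ 2 * ny ^+ 2).
    have := mulr_ge0 N0 (sqr_ge0 (om - l * ny)); lra.
  have : (l - N) * (om ^+ 2 + l ^+ 2 * ny ^+ 2) <= l * (K * ny * (l * eta * n)).
    have := ler_wpM2l (ltW l0) main; have := ler_wpM2l (ltW l0) cross.
    by move: amgm; lra.
  have := mulr_ge0 (ltW lN) (sqr_ge0 om) => h1 h2.
  have : (l ^+ 2 * ny) * ((l - N) * ny) <= (l ^+ 2 * ny) * (K * eta * n).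
    by move: h1 h2; lra.
  by rewrite ler_pM2l// mulr_gt0// exprn_gt0.
have : (l - N) * (l / 2 * n) <= L * (K * eta * n).
  apply: le_trans (ler_wpM2l (ltW lN) nLy) _.
  by rewrite mulrCA ler_wpM2l.
have -> : (l - N) * (l / 2 * n) = ((l - N) * l / 2) * n by field.
have -> : L * (K * eta * n) = (eta * (L * K)) * n by ring.
rewrite ler_pM2r// => fin.
have : 0 < (l - N) * l by rewrite mulr_gt0.
by move: fin eLK e0; lra.
Qed.

End Tuples.

(** * Heinz means *)

Definition heinz_mean (d : nat) (V : 'I_d -> H -> H) (B C : H -> H) :=
  fun (k : 'I_d) x => (1 / 2 : R)%:C *: (B (V k (C x)) + C (V k (B x))).

Lemma heinz_meanC (d : nat) (V : 'I_d -> H -> H) B C :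
  heinz_mean V B C = heinz_mean V C B.
Proof. by apply/funext => k; apply/funext => x; rewrite /heinz_mean addrC. Qed.

Lemma bounded_heinz_mean (d : nat) (V : 'I_d -> H -> H) B C k :
  (forall k, bounded_operator (V k)) -> bounded_operator B -> bounded_operator C ->
  bounded_operator (heinz_mean V B C k).
Proof.
move=> bV bB bC.
have -> : heinz_mean V B C k = fun x => (1 / 2 : R)%:C *: (B \o V k \o C) x +
    (1 / 2 : R)%:C *: (C \o V k \o B) x.
  by apply/funext => x; rewrite /heinz_mean scalerDr.
by apply: bounded_lin2; apply: bounded_comp => //; apply: bounded_comp.
Qed.

(** [operator_am_gm] for [Z = heinz_mean V Ba Cb]. The hypotheses abstract
    [A = P^((b-a)/2)], [Bx = P^x] and [Cx = P^(1-x)] for [x = a, b] and their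
    midpoint [m]. *)
Lemma heinz_mean_midpoint (d : nat) (V : 'I_d -> H -> H) A Ba Bm Bb Ca Cm Cb :
  (forall k, bounded_operator (V k)) ->
  bounded_operator A -> selfadjoint A ->
  bounded_operator Ba -> bounded_operator Ca ->
  bounded_operator Bb -> bounded_operator Cb ->
  (forall x, A (Ba x) = Bm x) -> (forall x, Ba (A x) = Bm x) ->
  (forall x, A (Bm x) = Bb x) -> (forall x, Bm (A x) = Bb x) ->
  (forall x, A (Cb x) = Cm x) -> (forall x, Cb (A x) = Cm x) ->
  (forall x, A (Cm x) = Ca x) -> (forall x, Cm (A x) = Ca x) ->
  joint_norm (heinz_mean V Bm Cm) <=
    (joint_norm (heinz_mean V Ba Ca) + joint_norm (heinz_mean V Bb Cb)) / 2.
Proof.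
move=> bV bA sA bBa bCa bBb bCb ABa BaA ABm BmA ACb CbA ACm CmA.
have [na0 na] := joint_normP (fun k => bounded_heinz_mean k bV bBa bCa).
have [nb0 nb] := joint_normP (fun k => bounded_heinz_mean k bV bBb bCb).
pose h := (1 / 2 : R)%:C.
have AL u v : A (h *: (u + v)) = h *: (A u + A v).
  by rewrite (linZ _ _ bA.1) (linD _ _ bA.1).
pose Z := heinz_mean V Ba Cb.
have -> : heinz_mean V Bm Cm = fun k => A \o Z k \o A.
  apply/funext => k; apply/funext => x.
  by rewrite /Z /heinz_mean /= AL ABa ACb BaA CbA.
apply: operator_am_gm => //.
- by move=> k; exact: bounded_heinz_mean.
- by rewrite divr_ge0// addr_ge0.
move=> x.
have e k : A (A (Z k x)) + Z k (A (A x)) =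
    heinz_mean V Ba Ca k x + heinz_mean V Bb Cb k x.
  rewrite /Z /heinz_mean !AL ABa ABm ACb ACm BaA BmA CbA CmA.
  by rewrite -!scalerDr [X in _ *: (X + _)]addrC addrACA
    [X in _ *: (X + _)]addrC.
under eq_bigr do rewrite e.
set p := joint_norm _ in na0 na *; set q := joint_norm _ in nb0 nb *.
have -> : 2 * ((p + q) / 2) * normR x = p * normR x + q * normR x by field.
by apply: Minkowski_family; rewrite ?mulr_ge0 ?normR_ge0.
Qed.

(** * The Heinz transform of a spherical polar decomposition *)

Section Polar.
Context (d : nat) (T V : 'I_d -> H -> H) (P : H -> H).
Context (T_bounded : forall k, bounded_operator (T k)).
Context (T_polar : spherical_polar ip T V P).

Let bV k : bounded_operator (V k).
Proof. by case: T_polar. Qed.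
Let posP : positive_operator ip P.
Proof. by case: T_polar => -[]. Qed.
Let bP : bounded_operator P := posP.1.
Let sP : selfadjoint P := positive_selfadjoint posP.

Lemma polar_modulus x : \sum_k normR (T k x) ^+ 2 = normR (P x) ^+ 2.
Proof.
have [[_ PP] _ _ _] := T_polar.
rewrite -rdot_xx sP -[P (P x)]/((P \o P) x) PP fct_sumE rdot_sumr.
by apply: eq_bigr => k _; rewrite -rdot_xx rdot_adjoint.
Qed.

(** With [Q] the projection in the polar decomposition, the sum is
    [<x, Q x> = `|Q x|^2]. *)
Lemma polar_contraction x : \sum_k normR (V k x) ^+ 2 <= normR x ^+ 2.
Proof.
have [_ _ _ QV] := T_polar.
set Q := (X in is_orthogonal_projection _ X _) in QV.
have -> : \sum_k normR (V k x) ^+ 2 = rdot x (Q x).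
  rewrite /Q fct_sumE rdot_sumr; apply: eq_bigr => k _.
  by rewrite -rdot_xx rdot_adjoint.
have [MQ xQ] := QV x.
have : rdot (x - Q x) (Q x) = 0 by rewrite /rdot xQ.
rewrite rdotDl rdotNl rdot_xx => /eqP; rewrite subr_eq0 => /eqP e.
have := CauchySchwarz x (Q x); rewrite e => h.
by have := sqr_ge0 (normR x - normR (Q x)); lra.
Qed.

Lemma polar_opnorm x : normR (P x) <= joint_norm T * normR x.
Proof.
have [T0 hT] := joint_normP T_bounded.
by rewrite -ler_sqr ?nnegrE ?normR_ge0 ?mulr_ge0 ?normR_ge0// -polar_modulus.
Qed.

Let pw t x := op_pow P t x.

Let pwD s t u x : 0 <= s -> 0 <= t -> s + t = u -> u <= 1 ->
  pw s (pw t x) = pw u x.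
Proof. by move=> s0 t0 <- st; rewrite /pw op_powD. Qed.

Let bpw t : 0 <= t <= 1 -> bounded_operator (pw t).
Proof. exact: op_pow_bounded. Qed.

Let spw t : 0 <= t <= 1 -> selfadjoint (pw t).
Proof. by move=> t01; apply: fc_selfadjoint (op_powP bP posP t01). Qed.

Lemma heinzE t : heinz V P t = heinz_mean V (pw t) (pw (1 - t)).
Proof.
by apply/funext => k; apply/funext => x; rewrite /heinz /gen_aluthge /= subKr.
Qed.

Lemma heinz_sym t : heinz V P (1 - t) = heinz V P t.
Proof. by rewrite !heinzE subKr heinz_meanC. Qed.

Lemma heinz0 : heinz V P 0 = spherical_mean T V P.
Proof.
have [_ _ TV _] := T_polar.
rewrite heinzE subr0; apply/funext => k; apply/funext => x.
by rewrite /heinz_mean /pw op_pow0// op_pow1// /spherical_mean TV.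
Qed.

Lemma heinz_half : heinz V P (1 / 2) = aluthge V P.
Proof.
rewrite heinzE; have -> : 1 - 1 / 2 = 1 / 2 :> R by field.
apply/funext => k; apply/funext => x; rewrite /aluthge /gen_aluthge /heinz_mean /=.
have -> : 1 - 1 / 2 = 1 / 2 :> R by field.
by rewrite scalerDr -scalerDl -rmorphD -splitr rmorph1 scale1r.
Qed.

Let f t := joint_norm (heinz V P t).

Lemma heinz_midconvex a b : 0 <= a -> a <= b -> b <= 1 ->
  f ((a + b) / 2) <= (f a + f b) / 2.
Proof.
move=> a0 ab b1; rewrite /f !heinzE.
apply: (@heinz_mean_midpoint _ _ (pw ((b - a) / 2))) => //;
  by [apply: bpw; lra|apply: spw; lra|move=> x; apply: pwD; lra].
Qed.

Lemma heinz_uniform_bound : exists C, forall t, 0 <= t <= 1 -> f t <= C.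
Proof.
pose M := opnorm P + 1; exists (M * M).
have M0 : 0 <= M by rewrite addr_ge0 ?opnorm_ge0.
move=> t t01; have t01' : 0 <= 1 - t <= 1 by lra.
apply: joint_norm_le => [|x]; first exact: mulr_ge0.
have one s : 0 <= s <= 1 -> 0 <= 1 - s <= 1 ->
    \sum_k normR (pw s (V k (pw (1 - s) x))) ^+ 2 <= (M * M * normR x) ^+ 2.
  move=> s01 s01'.
  have -> : (M * M * normR x) ^+ 2 = M ^+ 2 * (M * normR x) ^+ 2 by ring.
  apply: (@le_trans _ _ (M ^+ 2 * \sum_k normR (V k (pw (1 - s) x)) ^+ 2)).
    rewrite mulr_sumr; apply: ler_sum => k _; rewrite -exprMn.
    by rewrite ler_sqr ?nnegrE ?normR_ge0 ?mulr_ge0 ?normR_ge0// op_pow_bound.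
  rewrite ler_wpM2l ?sqr_ge0// (le_trans (polar_contraction _))//.
  by rewrite ler_sqr ?nnegrE ?normR_ge0 ?mulr_ge0 ?normR_ge0// op_pow_bound.
have B0 : 0 <= M * M * normR x by rewrite !mulr_ge0 ?normR_ge0.
have h1 := one t t01 t01'.
have h2 : \sum_k normR (pw (1 - t) (V k (pw t x))) ^+ 2 <= (M * M * normR x) ^+ 2.
  by have := one (1 - t); rewrite subKr; apply.
have := Minkowski_family B0 B0 h1 h2.
rewrite (eq_bigr (fun k => 4 * normR (heinz V P t k x) ^+ 2)) => [|k _].
  by rewrite -mulr_sumr; lra.
rewrite heinzE normRZ exprMn ger0_norm; last lra.
by field.
Qed.

Lemma heinz_interpolation t : 0 <= t <= 1 / 2 ->
  f t <= 2 * t * f (1 / 2) + (1 - 2 * t) * f 0.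
Proof.
have [C hC] := heinz_uniform_bound.
apply: (bounded_midconvex_interpolation (C := C)).
  by move=> s s01; apply: hC; lra.
by move=> a b a0 ab b2; apply: heinz_midconvex => //; lra.
Qed.

(** Both [T] and the Duggal transform [P V] have joint norm at most [`|T|]. *)
Lemma mean_le : f 0 <= joint_norm T.
Proof.
have [T0 hT] := joint_normP T_bounded; set l := joint_norm T in T0 hT *.
apply: joint_norm_le => // x; rewrite heinz0.
have hD : \sum_k normR (P (V k x)) ^+ 2 <= (l * normR x) ^+ 2.
  apply: (@le_trans _ _ (l ^+ 2 * \sum_k normR (V k x) ^+ 2)).
    rewrite mulr_sumr; apply: ler_sum => k _; rewrite -exprMn.
    by rewrite ler_sqr ?nnegrE ?normR_ge0 ?mulr_ge0 ?normR_ge0// polar_opnorm.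
  by rewrite exprMn ler_wpM2l ?sqr_ge0// polar_contraction.
have B0 : 0 <= l * normR x by rewrite mulr_ge0 ?normR_ge0.
have := Minkowski_family B0 B0 (hT x) hD.
rewrite (eq_bigr (fun k => 4 * normR (spherical_mean T V P k x) ^+ 2)) => [|k _].
  by rewrite -mulr_sumr; lra.
rewrite normRZ exprMn ger0_norm; last lra.
by rewrite /duggal /=; field.
Qed.

(** Midpoint convexity at [a = 0] and [b = 1], where [f] takes the same value. *)
Lemma heinz_half_le : f (1 / 2) <= f 0.
Proof.
have := @heinz_midconvex 0 1 (lexx 0) ler01 (lexx 1); rewrite add0r.
have -> : f 1 = f 0 by rewrite /f -(heinz_sym 0) subr0.
by move: (f (1 / 2)) (f 0) => u v; lra.
Qed.

End Polar.

End Hilbert.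

Theorem theorem2p1 (R : realType) (H : completeNormedModType R[i])
    (ip : {dot H for Num.conj}) (ip_norm : induces_norm ip)
    (H_separable : separable H)
    (d : nat) (d_gt0 : (0 < d)%N)
    (T : 'I_d -> H -> H) (T_bounded : forall k, bounded_operator (T k))
    (V : 'I_d -> H -> H) (P : H -> H) (T_polar : spherical_polar ip T V P) :
  (forall t : R, 0 <= t <= 1 ->
     let r0 := Num.min t (1 - t) in
     [/\ joint_norm (heinz V P t) <=
           2 * r0 * joint_norm (aluthge V P)
           + (1 - 2 * r0) * joint_norm (spherical_mean T V P),
         2 * r0 * joint_norm (aluthge V P)
           + (1 - 2 * r0) * joint_norm (spherical_mean T V P) <=
           joint_norm (spherical_mean T V P)
       & joint_norm (spherical_mean T V P) <= joint_norm T]) /\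
  (joint_norm (aluthge V P) <= joint_norm (spherical_mean T V P) /\
   joint_norm (spherical_mean T V P) <= joint_norm T).
Proof.
have mean_T := mean_le ip_norm T_bounded T_polar.
have half_mean := heinz_half_le ip_norm T_polar.
have interp := heinz_interpolation ip_norm T_polar.
rewrite !(heinz0 ip_norm T_polar) heinz_half in mean_T half_mean interp.
split => // t t01 r0.
have r0P : 0 <= r0 <= 1 / 2.
  by rewrite /r0 minEle; case: ifP => [|/negbT]; rewrite -?ltNge; lra.
have -> : heinz V P t = heinz V P r0.
  by rewrite /r0 minEle; case: ifP => // _; rewrite heinz_sym.
split => //; first exact: interp.
have : 0 <= 2 * r0 * (joint_norm (spherical_mean T V P) - joint_norm (aluthge V P)).
  by rewrite mulr_ge0 ?subr_ge0//; lra.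
by lra.
Qed.
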